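(* Let $m\ge 2$ be an integer, and let $f^{\mathrm{I}}_m:\Omega^+\to S^3_1$, $\tilde f^{\mathrm{I}}_m:\Omega\to S^3_1$, the singular set $\Sigma_m\subset\Omega$, the curve $\gamma_m$, the angles $\alpha_k$ and the set $\mathcal{C}^{\mathrm{I}}_m\subset S^3_1$ be as defined in the context. Then: (i) $\mathcal{C}^{\mathrm{I}}_m$ is a closed subset of $S^3_1$. If $m$ is odd, then $\mathcal{C}^{\mathrm{I}}_m$ is the closure in $S^3_1$ of the image of $f^{\mathrm{I}}_m$. If $m$ is even, then the closure $K$ in $S^3_1$ of the image of $f^{\mathrm{I}}_m$ is just half of $\mathcal{C}^{\mathrm{I}}_m$, and the other half is obtained by the isometric involution $\iota(t,x,y,z)=(-t,x,y,-z)$ of $S^3_1$; that is, $K\subsetneq\mathcal{C}^{\mathrm{I}}_m$ and $\mathcal{C}^{\mathrm{I}}_m=K\cup\iota(K)$. (ii) The set $$S:=\tilde f^{\mathrm{I}}_m(\Sigma_m)\cup\{(0,\gamma_m(\alpha_k),0)\,;\,k=0,\dots,2m-1\}$$ is compact, and $\mathcal{C}^{\mathrm{I}}_m$ is analytically immersed outside $S$, i.e. $\mathcal{C}^{\mathrm{I}}_m\setminus S$ is the image of a real analytic immersion of a 2-manifold into $S^3_1$.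
   Context: $\mathbb{R}^4_1$ is Lorentz–Minkowski 4-space with coordinates $(t,x,y,z)$ and metric $\langle\,,\rangle$ of signature $(-+++)$; $S^3_1=\{X\in\mathbb{R}^4_1;\langle X,X\rangle=1\}$ is de Sitter 3-space with the induced metric. Points $(t,x,y,z)$ are identified with Hermitian matrices $\begin{pmatrix}t+z & x+\mathrm{i}y \\ x-\mathrm{i}y & t-z\end{pmatrix}$, so that $S^3_1=\{ae_3a^*;a\in \mathrm{SL}(2,\mathbb{C})\}$ with $e_3=\begin{pmatrix}1&0\\0&-1\end{pmatrix}$ and $a^*$ the conjugate transpose. Let $S^1=\mathbb{R}/2\pi\mathbb{Z}$, $\Omega^{\pm}=\{(r,\theta)\in\mathbb{R}\times S^1;\pm r>0\}$, $\Omega=\Omega^+\cup\Omega^-$. The exceptional catenoid of type I is $f^{\mathrm{I}}_m=F^{\mathrm{I}}_m e_3(F^{\mathrm{I}}_m)^*:\mathbb{C}\setminus\{0\}\to S^3_1$ with $$F^{\mathrm{I}}_m=\frac{z^{-\frac{m+1}{2}}}{2\sqrt m}\begin{pmatrix}(m+1)z& z\bigl((m-1)z^m-m-1\bigr)\\ m-1&(m+1)z^m-m+1\end{pmatrix}.$$ With $z=re^{\mathrm{i}\theta}$ it is viewed as a map on $\Omega^+$; writing $f^{\mathrm{I}}_m=(x_0,x_1,x_2,x_3)$ in coordinates $(t,x,y,z)$ one has $$x_0\pm x_3=\frac{m^2-1}{4m}r^{\pm1}\Bigl(2\cos m\theta-\frac{m\mp1}{m\pm1}r^m\Bigr),$$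 $$x_1+\mathrm{i}x_2=\frac{(m-1)^2}{4m}e^{\mathrm{i}(m+1)\theta}+\frac{(m+1)^2}{4m}e^{-\mathrm{i}(m-1)\theta}-e^{\mathrm{i}\theta}\frac{m^2-1}{4m}r^m.$$ The same formulas make sense for $r<0$ and define the extension $\tilde f^{\mathrm{I}}_m:\Omega\to S^3_1$. Its singular set is $\Sigma_m=\{(r,\theta)\in\Omega;\ r^m+2\cos m\theta=0\}$. The plane curve $\gamma_m:\mathbb{R}\to\mathbb{R}^2\cong\mathbb{C}$ is $\gamma_m(\theta)=\lim_{r\to0}(x_1,x_2)$, i.e. $\gamma_m(\theta)=\frac{(m-1)^2}{4m}e^{\mathrm{i}(m+1)\theta}+\frac{(m+1)^2}{4m}e^{-\mathrm{i}(m-1)\theta}$. For $k=0,\dots,2m-1$ put $\alpha_k=\frac{2k+1}{2m}\pi$ and let $L_k=\{(t,\gamma_m(\alpha_k),-t);t\in\mathbb{R}\}\subset S^3_1$ (a light-like line). Finally $$\mathcal{C}^{\mathrm{I}}_m:=\tilde f^{\mathrm{I}}_m(\Omega)\cup L_0\cup\dots\cup L_{2m-1}.$$ *)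

(* Defs.v *)
From HB Require Import structures.
From mathcomp Require Import all_boot all_order all_algebra.
From mathcomp Require Import spectral complex.
From mathcomp Require Import all_classical all_reals all_analysis.
Import Order.TTheory GRing.Theory Num.Theory numFieldNormedType.Exports.

Set Implicit Arguments.
Unset Strict Implicit.
Unset Printing Implicit Defensive.

Local Open Scope classical_set_scope.
Local Open Scope complex_scope.
Local Open Scope sesquilinear_scope.
Local Open Scope ring_scope.

Section Analytic.
Variable R : realType.

(* Absolutely convergent double power series of g in h = (h_0, h_1) on a
   polydisc around p, summed along the diagonals i + j = n. *)
Definition analytic_at (g : 'rV[R]_2 -> R) (p : 'rV[R]_2) : Prop :=
  exists (a : nat -> nat -> R) (e : R), 0 < e /\
    forall h : 'rV[R]_2, `|h| < e ->
      let c i j := a i j * h 0 0 ^+ i * h 0 1 ^+ j in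
      cvgn (series (fun n => \sum_(i < n.+1) `|c i (n - i)%N|)) /\
      series (fun n => \sum_(i < n.+1) c i (n - i)%N) @ \oo --> g (p + h).

Definition analytic_on n (U : set 'rV[R]_2) (g : 'rV[R]_2 -> 'rV[R]_n) : Prop :=
  forall p, U p -> forall j, analytic_at (fun q => g q 0 j) p.

End Analytic.

Section Surfaces.
Variable R : realType.

(* A homeomorphism between open sets of M and of R^2; the values of chart_map
   off chart_dom, and of chart_inv off chart_cod, are irrelevant. *)
Record chart (M : topologicalType) := Chart {
  chart_dom : set M;
  chart_map : M -> 'rV[R]_2;
  chart_inv : 'rV[R]_2 -> M;
  chart_cod := chart_map @` chart_dom;
  open_chart_dom : open chart_dom;
  open_chart_cod : open chart_cod;
  chart_mapK : forall x, chart_dom x -> chart_inv (chart_map x) = x;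
  chart_map_continuous : {within chart_dom, continuous chart_map};
  chart_inv_continuous : {within chart_cod, continuous chart_inv} }.

Record analytic_surface := AnalyticSurface {
  carrier :> topologicalType;
  surface_hausdorff : hausdorff_space carrier;
  surface_second_countable : @second_countable carrier;
  atlas : set (chart carrier);
  atlas_cover : forall x, exists2 c, atlas c & chart_dom c x;
  atlas_compatible : forall c d, atlas c -> atlas d ->
    analytic_on (chart_map c @` (chart_dom c `&` chart_dom d))
                (chart_map d \o chart_inv c) }.

Definition analytic_immersion n (M : analytic_surface) (f : M -> 'rV[R]_n) :=
  forall c, atlas (a := M) c ->
    analytic_on (chart_cod c) (f \o chart_inv c) /\
    forall p, chart_cod c p -> injective ('d (f \o chart_inv c) p).

End Surfaces.

Section DeSitter.
Variable R : realType.

Definition point (t x y z : R) : 'rV[R]_4 := \row_(j < 4) [:: t; x; y; z]`_j.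

Definition lorentz (X Y : 'rV[R]_4) : R :=
  - (X 0 0 * Y 0 0) + X 0 1 * Y 0 1 + X 0 2%:R * Y 0 2%:R + X 0 3%:R * Y 0 3%:R.

Definition deSitter : set 'rV[R]_4 := [set X | lorentz X X = 1].

(* The point (t, x, y, z) with Hermitian matrix
   [[t + z, x + iy], [x - iy, t - z]]. *)
Definition point_of_hermitian (M : 'M[R[i]]_2) : 'rV[R]_4 :=
  point ((complex.Re (M 0 0) + complex.Re (M 1 1)) / 2)
        (complex.Re (M 0 1)) (complex.Im (M 0 1))
        ((complex.Re (M 0 0) - complex.Re (M 1 1)) / 2).

(* The tangent space of deSitter at X is the Lorentz-orthogonal of X. *)
Definition isometric_involution (g : 'rV[R]_4 -> 'rV[R]_4) : Prop :=
  [/\ forall X, deSitter X -> deSitter (g X),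
      forall X, deSitter X -> g (g X) = X
    & forall X, deSitter X -> differentiable g X /\
        forall V W, lorentz X V = 0 -> lorentz X W = 0 ->
          lorentz ('d g X V) ('d g X W) = lorentz V W].

Definition iota_tz (X : 'rV[R]_4) : 'rV[R]_4 :=
  point (- X 0 0) (X 0 1) (X 0 2%:R) (- X 0 3%:R).

End DeSitter.

Section Catenoid.
Variables (R : realType) (m : nat).
Local Notation mR := (m%:R : R).
Local Notation mC := (m%:R : R[i]).

Definition cis (theta : R) : R[i] := cos theta +i* sin theta.

Definition mat2 (a b c d : R[i]) : 'M[R[i]]_2 :=
  \matrix_(i < 2, j < 2) (nth [::] [:: [:: a; b]; [:: c; d]] i)`_j.

Definition e3 : 'M[R[i]]_2 := mat2 1 0 0 (-1).

(* z^(-(m+1)/2) is taken with the principal square root; the other branch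
   changes F by a sign, which cancels in F e3 F^*. *)
Definition F_I (z : R[i]) : 'M[R[i]]_2 :=
  (sqrtC z ^- m.+1 / (2 * sqrtC mC)) *:
  mat2 ((mC + 1) * z) (z * ((mC - 1) * z ^+ m - mC - 1))
       (mC - 1)       ((mC + 1) * z ^+ m - mC + 1).

Definition f_I (z : R[i]) : 'rV[R]_4 :=
  point_of_hermitian (F_I z *m e3 *m (F_I z)^t*).

(* A point of R x S^1 is given by (r, theta) with theta a real representative;
   everything below is 2 pi-periodic in theta. *)
Definition Omega_pos : set (R * R) := [set p | 0 < p.1].
Definition Omega : set (R * R) := [set p | p.1 != 0].

Definition f_I_polar (p : R * R) : 'rV[R]_4 := f_I (p.1%:C * cis p.2).

(* x_0 + x_3, x_0 - x_3 and x_1 + i x_2. *)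
Definition xplus (r theta : R) : R :=
  (mR ^+ 2 - 1) / (4 * mR) * r *
  (2 * cos (mR * theta) - (mR - 1) / (mR + 1) * r ^+ m).

Definition xminus (r theta : R) : R :=
  (mR ^+ 2 - 1) / (4 * mR) * r^-1 *
  (2 * cos (mR * theta) - (mR + 1) / (mR - 1) * r ^+ m).

Definition gamma_m (theta : R) : R[i] :=
  ((mR - 1) ^+ 2 / (4 * mR))%:C * cis ((mR + 1) * theta) +
  ((mR + 1) ^+ 2 / (4 * mR))%:C * cis (- ((mR - 1) * theta)).

Definition xplane (r theta : R) : R[i] :=
  gamma_m theta - cis theta * ((mR ^+ 2 - 1) / (4 * mR) * r ^+ m)%:C.

Definition f_I_ext (p : R * R) : 'rV[R]_4 :=
  point ((xplus p.1 p.2 + xminus p.1 p.2) / 2)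
        (complex.Re (xplane p.1 p.2)) (complex.Im (xplane p.1 p.2))
        ((xplus p.1 p.2 - xminus p.1 p.2) / 2).

Definition Sigma : set (R * R) :=
  [set p | Omega p /\ p.1 ^+ m + 2 * cos (mR * p.2) = 0].

Definition alpha (k : nat) : R := (2 * k%:R + 1) / (2 * mR) * pi.

Definition lightline (k : nat) : set 'rV[R]_4 :=
  [set point t (complex.Re (gamma_m (alpha k))) (complex.Im (gamma_m (alpha k)))
             (- t) | t in [set: R]].

Definition catenoid_I : set 'rV[R]_4 :=
  f_I_ext @` Omega `|` \bigcup_(k in `I_(2 * m)%N) lightline k.

Definition closure_f_I : set 'rV[R]_4 :=
  closure (f_I_polar @` Omega_pos : set (subspace (@deSitter R))).

Definition exceptional_set : set 'rV[R]_4 :=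
  f_I_ext @` Sigma `|`
  [set point 0 (complex.Re (gamma_m (alpha k))) (complex.Im (gamma_m (alpha k))) 0
      | k in `I_(2 * m)%N].

End Catenoid.

(* Main.v *)
Require Import Defs.
From HB Require Import structures.
From mathcomp Require Import all_boot all_order all_algebra.
From mathcomp Require Import complex.
From mathcomp Require Import all_classical all_reals all_analysis.
From mathcomp Require Import ring lra.
Import Order.TTheory GRing.Theory Num.Theory numFieldNormedType.Exports.
Local Open Scope classical_set_scope.
Local Open Scope ring_scope.

(** Write [amp = (m^2 - 1) / (4 m)] and [b = (m + 1) / (m - 1)].

    Closedness. The only singular coordinate of the extended catenoid is
    [x_0 - x_3 = amp (2 cos (m theta) - b r^m) / r]. Clearing the denominator gives
    a closed relation [on_graph] between [(r, theta)] and points of the de Sitter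
    space which, for [r <> 0], is the graph of [f_I_ext] and, for [r = 0], forces
    [cos (m theta) = 0] and describes exactly the lines [L_k]. So [C] is the
    projection of this relation ([catenoid_IE]). As [x_1] and [x_2] bound [|r|], and
    [theta] matters modulo [2 pi], the projection is locally along a compact set and
    has closed image ([closed_graph]). The same holds for the part [0 <= r], which
    is the image of [f_I] together with the lines. Each point of [L_k] is a limit of
    points [(r, alpha_k + r s)] with [r -> 0+], so this part is the closure [K] of
    the image of [f_I] ([closure_f_IE]). For odd [m] the relation is invariant under
    [(r, theta) -> (- r, theta + pi)], whence [C = K]. For even [m] the change of
    sign of [r] is the involution [iota_tz], whence [C] is the union of [K] and its
    image; they differ because [x_0 + x_3] is bounded above on [K] only.

    Compactness of [S]. On the singular set [x_0 - x_3 = - amp (1 + b) r^(m-1)], which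
    extends continuously to [r = 0] as [m >= 2]. So [S] is the image under
    [singular_map] of the compact set of solutions of [r^m + 2 cos (m theta) = 0]
    with [|r| <= 2] and [0 <= theta <= 2 pi] ([exceptional_setE]).

    Immersion. With [theta = alpha_k + r s] the numerator of [x_0 - x_3] becomes
    divisible by [r], as [cos (m alpha_k) = 0]; this gives an analytic map
    [patch_map m k] of the whole [(r, s)]-plane into [C] whose image contains [L_k]
    and all points with [r <> 0]. A computation of derivatives
    ([immersive_patch_map]) shows that it is immersive at every point that it does
    not send into [S]. The surface is the disjoint union, over [k < 2 m], of the
    preimages of the complement of [S] ([immersed_union_of_patches]).

    Analyticity is proved by showing that analytic functions form a ring, via the
    Cauchy product, and that it contains [sin] and [cos] of affine functions of the
    product [r s], via the addition formulas; it also yields differentiability. *)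

(** * Diagonal sums and the Cauchy product *)

(** The sum of the terms of total degree [n] of a double array; the power series
    of an analytic function is summed along these diagonals. *)
Definition diag {V : nmodType} (n : nat) (G : nat -> nat -> V) : V :=
  \sum_(i < n.+1) G i (n - i)%N.

Lemma eq_diag {V : nmodType} n (G H : nat -> nat -> V) :
  (forall i j, (i + j)%N = n -> G i j = H i j) -> diag n G = diag n H.
Proof. by move=> GH; apply: eq_bigr => i _; apply: GH; rewrite subnKC // -ltnS ltn_ord. Qed.

Lemma diagC {V : nmodType} n (G : nat -> nat -> V) :
  diag n G = diag n (fun i j => G j i).
Proof.
rewrite /diag (reindex_inj rev_ord_inj) /=; apply: eq_bigr => i _.
by rewrite subSS subKn // -ltnS ltn_ord.
Qed.

Lemma sum_triangle {V : nmodType} (N : nat) (G : nat -> nat -> V) :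
  \sum_(i < N) diag i G = \sum_(i < N) \sum_(j < N - i) G i j.
Proof.
elim: N => [|N IH]; first by rewrite !big_ord0.
rewrite big_ord_recr IH [RHS]big_ord_recr /= subSnn big_ord1 /diag big_ord_recr.
rewrite /= addrA -big_split /=; congr (_ + G _ _); last exact: subnn.
by apply: eq_bigr => i _; rewrite subSn ?big_ord_recr // ltnW.
Qed.

Lemma diagA {V : nmodType} n (G : nat -> nat -> nat -> V) :
  diag n (fun i j => diag i (fun k l => G k l j)) =
  diag n (fun k i => diag i (fun l j => G k l j)).
Proof.
transitivity (\sum_(i < n.+1) diag i (fun k l => G k l (n - (k + l))%N)).
  apply: eq_bigr => i _; apply: eq_diag => k l <-.
  by [].
rewrite sum_triangle; apply: eq_bigr => k _.
have k_le : (k <= n)%N by rewrite -ltnS ltn_ord.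
by rewrite /diag (subSn k_le); apply: eq_bigr => l _; rewrite subnDA.
Qed.

(** The two ways of grouping a sum over [i1 + i2 + j1 + j2 = n]; this is what
    makes the product of two double power series a Cauchy product. *)
Lemma diagACA {V : nmodType} n (F : nat -> nat -> nat -> nat -> V) :
  diag n (fun i j => diag i (fun i1 i2 => diag j (fun j1 j2 => F i1 i2 j1 j2))) =
  diag n (fun k l => diag k (fun i1 j1 => diag l (fun i2 j2 => F i1 i2 j1 j2))).
Proof.
rewrite (diagA n (fun i1 i2 j => diag j (fun j1 j2 => F i1 i2 j1 j2))).
rewrite (diagA n (fun i1 j1 l => diag l (fun i2 j2 => F i1 i2 j1 j2))).
apply: eq_diag => i1 k _.
rewrite -(diagA k (fun i2 j1 j2 => F i1 i2 j1 j2)).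
rewrite -(diagA k (fun j1 i2 j2 => F i1 i2 j1 j2)).
by apply: eq_diag => i j _; rewrite diagC.
Qed.

Section Cauchy.
Context {R : realType}.
Implicit Types a b : nat -> R.

Lemma ler_diag n (G H : nat -> nat -> R) :
  (forall i j, (i + j)%N = n -> G i j <= H i j) -> diag n G <= diag n H.
Proof.
by move=> GH; apply: ler_sum => i _; apply: GH; rewrite subnKC // -ltnS ltn_ord.
Qed.

Lemma ler_norm_diag n (G : nat -> nat -> R) :
  `|diag n G| <= diag n (fun i j => `|G i j|).
Proof. exact: ler_norm_sum. Qed.

Lemma diag_mull n (F : nat -> nat -> R) x :
  diag n F * x = diag n (fun i j => F i j * x).
Proof. exact: mulr_suml. Qed.

Lemma diag_mul n1 n2 (F G : nat -> nat -> R) :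
  diag n1 F * diag n2 G = diag n1 (fun i j => diag n2 (fun k l => F i j * G k l)).
Proof.
by rewrite /diag mulr_suml; apply: eq_bigr => i _; rewrite mulr_sumr.
Qed.

Lemma series_ord a n : series a n = \sum_(i < n) a i.
Proof. by rewrite /series /= big_mkord. Qed.

Definition cauchy_prod a b n := diag n (fun i j => a i * b j).

(** The defect is the sum of the [a i * b j] with [i, j < n <= i + j], so it is
    dominated by the defect of the series of absolute values. *)
Lemma cauchy_prod_defect a b n :
  `|series a n * series b n - series (cauchy_prod a b) n| <=
  series (fun n => `|a n|) n * series (fun n => `|b n|) n
  - series (cauchy_prod (fun n => `|a n|) (fun n => `|b n|)) n.
Proof.
have defectE u v : series u n * series v n - series (cauchy_prod u v) n =
    \sum_(i < n) u i * \sum_(n - i <= j < n) v j.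
  rewrite !series_ord sum_triangle mulr_suml -sumrB; apply: eq_bigr => i _.
  rewrite -mulr_sumr -mulrBr; congr (_ * _).
  rewrite -!(big_mkord xpredT v).
  by rewrite (@big_cat_nat _ _ _ (n - i)%N) ?leq_subr //= addrAC subrr add0r.
rewrite !defectE; apply: le_trans (ler_norm_sum _ _ _) _; apply: ler_sum => i _.
by rewrite normrM ler_wpM2l //; exact: ler_norm_sum.
Qed.

(** For nonnegative terms, the partial sums [U] of the Cauchy product satisfy
    [U n <= S n * T n <= U (n + n)]; hence they have the limit of [S n * T n].
    The signed case follows because its defect is dominated. *)
Lemma cauchy_prod_cvg a b (A B : R) :
  cvgn (series (fun n => `|a n|)) -> cvgn (series (fun n => `|b n|)) ->
  series a @ \oo --> A -> series b @ \oo --> B ->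
  cvgn (series (cauchy_prod (fun n => `|a n|) (fun n => `|b n|))) /\
  series (cauchy_prod a b) @ \oo --> A * B.
Proof.
move=> ca cb aA bB.
set a' := fun n => `|a n|; set b' := fun n => `|b n|.
set S := series a'; set T := series b'; set U := series (cauchy_prod a' b').
have U_nd : nondecreasing_seq U.
  apply: nondecreasing_series => i _ _.
  by apply: sumr_ge0 => j _; apply: mulr_ge0 => //; exact: normr_ge0.
have U_le n : U n <= S n * T n.
  by rewrite -subr_ge0; apply: le_trans (cauchy_prod_defect a b n); exact: normr_ge0.
have U_ge n : S n * T n <= U (n + n)%N.
  rewrite /U /S /T !series_ord sum_triangle mulr_suml big_split_ord /=.
  rewrite -[leLHS]addr0.
  apply: lerD; last first.
    by apply: sumr_ge0 => i _; apply: sumr_ge0 => j _; apply: mulr_ge0; exact: normr_ge0.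
  apply: ler_sum => i _; rewrite -mulr_sumr ler_wpM2l ?normr_ge0 //.
  rewrite -addnBA 1?ltnW // big_split_ord /= lerDl.
  by apply: sumr_ge0 => j _; exact: normr_ge0.
have ST : (fun n => S n * T n) @ \oo --> limn S * limn T by apply: cvgM.
have STbd : has_ubound (range (fun n => S n * T n)).
  apply: bounded_fun_has_ubound; apply: cvg_seq_bounded; apply/cvg_ex.
  by exists (limn S * limn T).
have cU : cvgn U.
  apply: nondecreasing_is_cvgn => //; case: STbd => M HM; exists M => _ [n _ <-].
  by apply: le_trans (U_le n) (HM _ _); exists n.
split=> //.
have U_lim n : S n * T n <= limn U.
  by apply: le_trans (U_ge n) _; exact: nondecreasing_cvgn_le.
have UST : limn U = limn S * limn T.
  apply/eqP; rewrite eq_le; apply/andP; split.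
    have <- : limn (fun n => S n * T n) = limn S * limn T by apply/cvg_lim.
    by apply: ler_lim => //; [apply/cvg_ex; exists (limn S * limn T) | exact: nearW].
  have <- : limn (fun n => S n * T n) = limn S * limn T by apply/cvg_lim.
  by apply: limr_le; [apply/cvg_ex; exists (limn S * limn T) | exact: nearW].
have D0 : (fun n => S n * T n - U n) @ \oo --> (0 : R).
  by rewrite -(subrr (limn U)) {1}UST; apply: cvgB.
have E0 : (fun n => series a n * series b n - series (cauchy_prod a b) n) @ \oo --> (0 : R).
  apply: norm_cvg0; apply: (@squeeze_cvgr _ _ _ _ (cst 0) (fun n => S n * T n - U n)).
  - by apply: nearW => n /=; rewrite normr_ge0 cauchy_prod_defect.
  - exact: cvg_cst.
  - exact: D0.
rewrite -(subr0 (A * B)).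
rewrite (_ : series (cauchy_prod a b) = fun n => series a n * series b n -
  (series a n * series b n - series (cauchy_prod a b) n)); last first.
  by apply/funext => n; rewrite opprB addrC subrK.
by apply: cvgB => //; apply: cvgM.
Qed.

End Cauchy.

(** * Analytic functions of two variables *)

Lemma forall_ord2 (P : 'I_2 -> Prop) : P 0 -> P 1 -> forall j, P j.
Proof.
move=> P0 P1 [[|[|//]] j_lt].
  by rewrite (_ : Ordinal j_lt = 0) //; exact: val_inj.
by rewrite (_ : Ordinal j_lt = 1) //; exact: val_inj.
Qed.

Lemma forall_ord4 (P : 'I_4 -> Prop) :
  P 0 -> P 1 -> P 2%:R -> P 3%:R -> forall j, P j.
Proof.
move=> P0 P1 P2 P3 [[|[|[|[|//]]]] j_lt].
- by rewrite (_ : Ordinal j_lt = 0) //; exact: val_inj.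
- by rewrite (_ : Ordinal j_lt = 1) //; exact: val_inj.
- by rewrite (_ : Ordinal j_lt = 2%:R) //; exact: val_inj.
- by rewrite (_ : Ordinal j_lt = 3%:R) //; exact: val_inj.
Qed.

Section RowNorm.
Context {R : realType} {n : nat}.
Implicit Type h : 'rV[R]_n.

Lemma ler_coord_norm h j : `|h 0 j| <= `|h|.
Proof.
rewrite [leRHS]mx_normrE.
exact: (le_bigmax _ (fun ij : 'I_1 * 'I_n => `|h ij.1 ij.2|) (0, j)).
Qed.

Lemma row_norm_lt h (e : R) : 0 < e -> (forall j, `|h 0 j| < e) -> `|h| < e.
Proof.
move=> e0 he; rewrite [ltLHS]mx_normrE; apply: bigmax_lt => // -[i j] _ /=.
by rewrite ord1.
Qed.

End RowNorm.

Section AnalyticAt.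
Context {R : realType}.
Implicit Types (g : 'rV[R]_2 -> R) (p h : 'rV[R]_2) (a b : nat -> nat -> R).

Let monomial a h i j : R := a i j * h 0 0 ^+ i * h 0 1 ^+ j.

Let analytic_atP g p : analytic_at g p <->
  exists a (e : R), 0 < e /\ forall h, `|h| < e ->
    cvgn (series (fun n => diag n (fun i j => `|monomial a h i j|))) /\
    series (fun n => diag n (monomial a h)) @ \oo --> g (p + h).
Proof. by []. Qed.

Lemma near_eq_analytic_at g1 g2 p :
  (\forall q \near p, g1 q = g2 q) -> analytic_at g1 p -> analytic_at g2 p.
Proof.
move=> /nbhs0P/nbhs_normP[d /= d0 g12] [a [e [e0 ga]]].
exists a, (Num.min d e); split; first by rewrite lt_min d0.
move=> h; rewrite lt_min => /andP[hd he]; have [c1 c2] := ga h he; split=> //.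
by rewrite -g12 //= sub0r normrN.
Qed.

Lemma analytic_atD g1 g2 p : analytic_at g1 p -> analytic_at g2 p ->
  analytic_at (fun q => g1 q + g2 q) p.
Proof.
move=> /analytic_atP[a [d [d0 ga]]] /analytic_atP[b [e [e0 gb]]]; apply/analytic_atP.
exists (fun i j => a i j + b i j), (Num.min d e); split; first by rewrite lt_min d0.
move=> h; rewrite lt_min => /andP[/ga[a1 a2] /gb[b1 b2]].
have monoD i j : monomial (fun i j => a i j + b i j) h i j =
  monomial a h i j + monomial b h i j by rewrite /monomial !mulrDl.
split.
  have := is_cvg_seriesD a1 b1; apply: series_le_cvg => n /=.
  - by apply: sumr_ge0.
  - by apply: addr_ge0; apply: sumr_ge0.
  rewrite -[leRHS]big_split /=; apply: ler_sum => i _; rewrite monoD.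
  exact: ler_normD.
rewrite (_ : (fun n => _) = (fun n => diag n (monomial a h)) +
                            (fun n => diag n (monomial b h))).
  by rewrite seriesD; apply: cvgD.
apply/funext => n /=; rewrite -[RHS]big_split /=.
by apply: eq_bigr => i _.
Qed.

Lemma analytic_atM g1 g2 p : analytic_at g1 p -> analytic_at g2 p ->
  analytic_at (fun q => g1 q * g2 q) p.
Proof.
move=> /analytic_atP[a [d [d0 ga]]] /analytic_atP[b [e [e0 gb]]]; apply/analytic_atP.
pose c i j := diag i (fun i1 i2 => diag j (fun j1 j2 => a i1 j1 * b i2 j2)).
exists c, (Num.min d e); split; first by rewrite lt_min d0.
move=> h; rewrite lt_min => /andP[/ga[a1 a2] /gb[b1 b2]].
have monoM i j : monomial c h i j = diag i (fun i1 i2 => diag j (fun j1 j2 =>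
    monomial a h i1 j1 * monomial b h i2 j2)).
  rewrite /monomial /c !diag_mull; apply: eq_diag => i1 i2 <-.
  rewrite !diag_mull; apply: eq_diag => j1 j2 <-.
  by rewrite !exprD; ring.
have diag_monoM n : diag n (monomial c h) =
    cauchy_prod (fun n => diag n (monomial a h)) (fun n => diag n (monomial b h)) n.
  rewrite (eq_diag _ _ _ (fun i j _ => monoM i j)) diagACA.
  by apply: eq_diag => k l _; rewrite diag_mul.
pose abs_diag (u : nat -> nat -> R) n : R := diag n (fun i j => `|u i j|).
have abs_diagK u : (fun n => `|abs_diag u n|) = abs_diag u.
  by apply/funext => n; rewrite ger0_norm //; apply: sumr_ge0.
split.
  have [] := cauchy_prod_cvg (abs_diag (monomial a h)) (abs_diag (monomial b h))
    (limn (series (abs_diag (monomial a h)))) (limn (series (abs_diag (monomial b h)))).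
  - by rewrite abs_diagK.
  - by rewrite abs_diagK.
  - exact: a1.
  - exact: b1.
  rewrite !abs_diagK => cab _; apply: series_le_cvg cab => n.
  - by apply: sumr_ge0.
  - by apply: sumr_ge0 => i _; apply: mulr_ge0; apply: sumr_ge0.
  rewrite [leRHS](_ : _ = diag n (fun i j => diag i (fun i1 j1 => diag j (fun i2 j2 =>
    `|monomial a h i1 j1| * `|monomial b h i2 j2|)))); last first.
    by apply: eq_diag => k l _; rewrite diag_mul.
  rewrite -diagACA; apply: ler_diag => i j _; rewrite monoM.
  apply: le_trans (ler_norm_diag _ _) _; apply: ler_diag => i1 i2 _.
  apply: le_trans (ler_norm_diag _ _) _; apply: ler_diag => j1 j2 _.
  by rewrite normrM.
have norm_cvg (u : nat -> nat -> R) : cvgn (series (fun n => diag n (fun i j => `|u i j|))) ->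
    cvgn (series (fun n => `|diag n u|)).
  apply: series_le_cvg => n //; first by apply: sumr_ge0.
  exact: ler_norm_diag.
have [_] := cauchy_prod_cvg _ _ _ _ (norm_cvg _ a1) (norm_cvg _ b1) a2 b2.
rewrite (_ : cauchy_prod _ _ = fun n => diag n (monomial c h)) //.
by apply/funext => n; rewrite diag_monoM.
Qed.

(** Absolute convergence is part of the requirement, as it is in [analytic_at];
    it is what products need. *)
Definition power_series_at0 (phi : R -> R) := exists (b : nat -> R) (e : R), 0 < e /\
  forall x, `|x| < e -> cvgn (series (fun n => `|b n * x ^+ n|)) /\
    series (fun n => b n * x ^+ n) @ \oo --> phi x.

Lemma diag_row n (u : nat -> R) :
  diag n (fun i j => if j == 0%N then u i else 0) = u n.
Proof.
rewrite /diag big_ord_recr /= subnn eqxx big1 ?add0r // => i _.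
by rewrite subn_eq0 leqNgt ltn_ord.
Qed.

Lemma diag_col n (u : nat -> R) :
  diag n (fun i j => if i == 0%N then u j else 0) = u n.
Proof. by rewrite diagC diag_row. Qed.

Lemma diag_diag n (u : nat -> R) :
  diag n (fun i j => if i == j then u i else 0) = if odd n then 0 else u n./2.
Proof.
rewrite /diag; case: (boolP (odd n)) => on.
  rewrite big1 // => i _; case: eqP => // ni.
  have := ltn_ord i; rewrite ltnS => le_in.
  by have := congr1 odd (subnK le_in); rewrite -ni oddD addbb on.
have nE : n = (n./2 + n./2)%N.
  by rewrite addnn -[LHS]odd_double_half (negbTE on).
have n2 : (n./2 < n.+1)%N by rewrite ltnS [leqRHS]nE leq_addr.
rewrite (bigD1 (Ordinal n2)) //= [X in (X - _)%N]nE addnK eqxx big1 ?addr0 //.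
move=> i /eqP i_ne; case: eqP => // ni; case: i_ne; apply: val_inj => /=.
have := ltn_ord i; rewrite ltnS => le_in.
by have := congr1 half (subnK le_in); rewrite -ni addnn doubleK.
Qed.

Lemma series_even (u : nat -> R) (l : R) :
  series u @ \oo --> l ->
  series (fun n => if odd n then 0 else u n./2) @ \oo --> l.
Proof.
move=> ul.
rewrite (_ : series _ = (series u) \o uphalf).
  apply: cvg_comp ul; move=> A [N _ NA]; exists N.*2 => // n /= nN; apply: NA => /=.
  by rewrite geq_uphalf_double; exact: leqW.
apply/funext => n /=; elim: n => [|n IH]; first by rewrite !series_ord !big_ord0.
rewrite seriesSr IH /= uphalf_half; case: (odd n) => /=.
  by rewrite addr0 add1n.
by rewrite add0n seriesSr.
Qed.

Lemma analytic_at_coord0 phi p : power_series_at0 phi ->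
  analytic_at (fun q => phi (q 0 0 - p 0 0)) p.
Proof.
move=> [b [e [e0 bphi]]]; apply/analytic_atP.
exists (fun i j => if j == 0%N then b i else 0), e; split=> // h he.
have [c1 c2] := bphi (h 0 0) (le_lt_trans (ler_coord_norm _ _) he).
have mE i j : monomial (fun i j => if j == 0%N then b i else 0) h i j =
    if j == 0%N then b i * h 0 0 ^+ i else 0.
  by rewrite /monomial; case: eqP => [->|_]; rewrite ?mul0r ?mulr1.
rewrite mxE addrAC subrr add0r; split.
  rewrite (_ : (fun n => _) = (fun n => `|b n * h 0 0 ^+ n|)) //.
  apply/funext => n; rewrite -[RHS](diag_row _ (fun n => `|b n * h 0 0 ^+ n|)).
  by apply: eq_diag => i j _; rewrite mE; case: eqP => // _; rewrite normr0.
rewrite (_ : (fun n => _) = (fun n => b n * h 0 0 ^+ n)) //.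
apply/funext => n; rewrite -[RHS](diag_row _ (fun n => b n * h 0 0 ^+ n)).
by apply: eq_diag => i j _; rewrite mE.
Qed.

Lemma analytic_at_coord1 phi p : power_series_at0 phi ->
  analytic_at (fun q => phi (q 0 1 - p 0 1)) p.
Proof.
move=> [b [e [e0 bphi]]]; apply/analytic_atP.
exists (fun i j => if i == 0%N then b j else 0), e; split=> // h he.
have [c1 c2] := bphi (h 0 1) (le_lt_trans (ler_coord_norm _ _) he).
have mE i j : monomial (fun i j => if i == 0%N then b j else 0) h i j =
    if i == 0%N then b j * h 0 1 ^+ j else 0.
  by rewrite /monomial; case: eqP => [->|_]; rewrite ?mul0r ?mulr1.
rewrite mxE addrAC subrr add0r; split.
  rewrite (_ : (fun n => _) = (fun n => `|b n * h 0 1 ^+ n|)) //.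
  apply/funext => n; rewrite -[RHS](diag_col _ (fun n => `|b n * h 0 1 ^+ n|)).
  by apply: eq_diag => i j _; rewrite mE; case: eqP => // _; rewrite normr0.
rewrite (_ : (fun n => _) = (fun n => b n * h 0 1 ^+ n)) //.
apply/funext => n; rewrite -[RHS](diag_col _ (fun n => b n * h 0 1 ^+ n)).
by apply: eq_diag => i j _; rewrite mE.
Qed.

(** The monomials [(u v)^n] sit on the even diagonals only. *)
Lemma analytic_at_coord01 phi p : power_series_at0 phi ->
  analytic_at (fun q => phi ((q 0 0 - p 0 0) * (q 0 1 - p 0 1))) p.
Proof.
move=> [b [e [e0 bphi]]]; apply/analytic_atP.
exists (fun i j => if i == j then b i else 0), (Num.min 1 e).
split; first by rewrite lt_min ltr01.
move=> h; rewrite lt_min => /andP[h1 he].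
have hh : `|h 0 0 * h 0 1| < e.
  rewrite normrM (le_lt_trans _ he) // -[leRHS]mulr1.
  by rewrite ler_pM ?ler_coord_norm // (le_trans (ler_coord_norm _ _)) ?ltW.
have [c1 c2] := bphi _ hh.
have mE i j : monomial (fun i j => if i == j then b i else 0) h i j =
    if i == j then b i * (h 0 0 * h 0 1) ^+ i else 0.
  by rewrite /monomial; case: eqP => [->|_]; rewrite ?mul0r // exprMn mulrA.
rewrite !mxE ![_ + h _ _]addrC !addrK; split.
  rewrite (_ : (fun n => _) = (fun n => if odd n then 0
      else `|b n./2 * (h 0 0 * h 0 1) ^+ n./2|)).
    by apply/cvg_ex; case/cvg_ex: c1 => l cl; exists l;
      exact: (series_even (fun n => `|b n * (h 0 0 * h 0 1) ^+ n|)).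
  apply/funext => n; rewrite -[RHS](diag_diag _ (fun n => `|b n * (h 0 0 * h 0 1) ^+ n|)).
  by apply: eq_diag => i j _; rewrite mE; case: eqP => // _; rewrite normr0.
rewrite (_ : (fun n => _) = (fun n => if odd n then 0
    else b n./2 * (h 0 0 * h 0 1) ^+ n./2));
  first exact: (series_even (fun n => b n * (h 0 0 * h 0 1) ^+ n)).
apply/funext => n; rewrite -[RHS](diag_diag _ (fun n => b n * (h 0 0 * h 0 1) ^+ n)).
by apply: eq_diag => i j _; rewrite mE.
Qed.

End AnalyticAt.

(** * Power series of the trigonometric functions *)

Section EntireSeries.
Context {R : realType}.
Implicit Types (x y : R) (phi : R -> R).

Lemma series_finite (u : nat -> R) N :
  (forall n, (N <= n)%N -> u n = 0) -> series u @ \oo --> series u N.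
Proof.
move=> uN; apply: cvg_near_cst; exists N => // n /= /subnKC <-.
elim: (n - N)%N => [|k IH]; first by rewrite addn0.
by rewrite addnS seriesSr IH uN ?addr0 // leq_addr.
Qed.

Lemma power_series_cst (c : R) : power_series_at0 (fun=> c).
Proof.
exists (fun n => if n == 0%N then c else 0), 1; split=> // x _.
have fin n : (1 <= n)%N -> (if n == 0%N then c else 0) * x ^+ n = 0.
  by case: n => // n _; rewrite mul0r.
split; last by have := series_finite _ _ fin; rewrite series_ord big_ord1 mulr1.
apply/cvg_ex; exists (series (fun n => `|(if n == 0%N then c else 0) * x ^+ n|) 1).
by apply: series_finite => n /fin ->; rewrite normr0.
Qed.

Lemma power_series_id : power_series_at0 (@id R).
Proof.
exists (fun n => (n == 1%N)%:R), 1; split=> // x _.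
have fin n : (2 <= n)%N -> (n == 1%N)%:R * x ^+ n = 0.
  by case: n => [|[|n]] // _; rewrite mul0r.
split.
  apply/cvg_ex; exists (series (fun n => `|(n == 1%N)%:R * x ^+ n|) 2).
  by apply: series_finite => n /fin ->; rewrite normr0.
have := series_finite _ _ fin.
by rewrite series_ord !big_ord_recl big_ord0 /= mul0r mul1r addr0 add0r.
Qed.

Lemma power_series_scale phi (k : R) :
  power_series_at0 phi -> power_series_at0 (fun x => phi (k * x)).
Proof.
move=> [b [e [e0 bphi]]]; exists (fun n => b n * k ^+ n), (e / (`|k| + 1)).
have k0 : 0 < `|k| + 1 by rewrite ltr_wpDl.
split=> [|x xe]; first by rewrite divr_gt0.
have kx : `|k * x| < e.
  rewrite normrM; apply: le_lt_trans (_ : (`|k| + 1) * `|x| < _).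
    by rewrite ler_wpM2r ?lerDl.
  by rewrite mulrC -ltr_pdivlMr.
have [c1 c2] := bphi _ kx.
have coefE : (fun n => b n * k ^+ n * x ^+ n) = (fun n => b n * (k * x) ^+ n).
  by apply/funext => n; rewrite exprMn mulrA.
rewrite coefE; split=> //.
by rewrite (_ : (fun n => `|_|) = (fun n => `|b n * (k * x) ^+ n|)) //;
  apply/funext => n; rewrite exprMn mulrA.
Qed.

Lemma entire_series phi (b : nat -> R) :
  (forall n, `|b n| <= (n`!%:R)^-1) ->
  (forall x, series (fun n => b n * x ^+ n) @ \oo --> phi x) ->
  power_series_at0 phi.
Proof.
move=> b_le bphi; exists b, 1; split=> // x _; split=> //.
apply: (series_le_cvg _ _ _ (is_cvg_series_exp_coeff `|x|)) => n //.
  by rewrite /exp_coeff /= divr_ge0 // exprn_ge0.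
by rewrite normrM normrX /exp_coeff /= mulrC ler_wpM2l // exprn_ge0.
Qed.

Let sin_coef n : R := (odd n)%:R * (-1) ^+ n.-1./2 / n`!%:R.
Let cos_coef n : R := (~~ odd n)%:R * (-1) ^+ n./2 / n`!%:R.

Let norm_coef (s : bool) k n : `|s%:R * (-1) ^+ k / n`!%:R| <= (n`!%:R : R)^-1.
Proof.
rewrite !normrM normfV !normr_nat normrX normrN normr1 expr1n mulr1.
by case: s; rewrite ?mul1r ?mul0r ?invr_ge0.
Qed.

Let sin_series x : series (fun n => sin_coef n * x ^+ n) @ \oo --> sin x.
Proof.
rewrite (_ : (fun n => _) = sin_coeff x); last by rewrite sin_coeffE.
by rewrite sin.unlock; exact: is_cvg_series_sin_coeff.
Qed.

Lemma power_series_sin : power_series_at0 (@sin R).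
Proof. by apply: (entire_series _ sin_coef) => // n; exact: norm_coef. Qed.

Lemma power_series_cos : power_series_at0 (@cos R).
Proof.
apply: (entire_series _ cos_coef) => [n|x]; first exact: norm_coef.
rewrite (_ : (fun n => _) = cos_coeff x); last by rewrite cos_coeffE.
by rewrite cos.unlock; exact: is_cvg_series_cos_coeff.
Qed.

(** Needed because [sin (k r s) / r] must be continued across [r = 0]. *)
Definition sinc x : R := if x == 0 then 1 else sin x / x.

Lemma mul_sinc x : x * sinc x = sin x.
Proof.
by rewrite /sinc; case: eqP => [->|/eqP x0]; rewrite ?mul0r ?sin0 // mulrC divfK.
Qed.

Lemma sinc0 : sinc 0 = 1. Proof. by rewrite /sinc eqxx. Qed.

Lemma power_series_sinc : power_series_at0 sinc.
Proof.
apply: (entire_series _ (fun n => sin_coef n.+1)) => [n|x].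
  apply: le_trans (norm_coef _ _ _) _.
  rewrite lef_pV2 ?posrE ?ltr0n ?fact_gt0 // ler_nat factS.
  by rewrite leq_pmull.
have [->|x0] := eqVneq x 0.
  rewrite sinc0; have -> : (1 : R) = series (fun n => sin_coef n.+1 * 0 ^+ n) 1.
    by rewrite series_ord big_ord1 /sin_coef /= expr0 !mul1r mulr1 invr1.
  by apply: series_finite => -[|n] // _; rewrite expr0n mulr0.
rewrite /sinc (negbTE x0).
have := sin_series x; rewrite -cvg_shiftS => sx.
rewrite (_ : series _ = (fun n => series (fun k => sin_coef k * x ^+ k) n.+1 / x)).
  by apply: cvgM => //; exact: cvg_cst.
apply/funext => n; rewrite !series_ord big_ord_recl.
have -> : sin_coef (ord0 : 'I_n.+1) = 0 by rewrite /sin_coef /= !mul0r.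
rewrite mul0r add0r mulr_suml; apply: eq_bigr => i _.
by rewrite lift0 exprSr mulrA mulfK.
Qed.

Lemma power_series_inv (r : R) : r != 0 -> power_series_at0 (fun x => (r + x)^-1).
Proof.
move=> r0; exists (fun n => r^-1 * (- r^-1) ^+ n), `|r|; split=> [|x xr].
  by rewrite normr_gt0.
have z1 : `|- (x / r)| < 1 by rewrite normrN normrM normfV ltr_pdivrMr ?normr_gt0 ?mul1r.
have E n : r^-1 * (- r^-1) ^+ n * x ^+ n = geometric r^-1 (- (x / r)) n.
  by rewrite /geometric /= -mulrA -exprMn mulNr mulrC [_ * x]mulrC [RHS]mulrC.
split.
  rewrite (_ : (fun n => _) = geometric `|r^-1| `|- (x / r)|).
    by apply: is_cvg_geometric_series; rewrite normr_id.
  by apply/funext => n; rewrite E /geometric /= normrM normrX.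
rewrite (_ : (fun n => _) = geometric r^-1 (- (x / r))).
  rewrite (_ : (r + x)^-1 = r^-1 / (1 - - (x / r))).
    exact: cvg_geometric_series.
  by rewrite opprK -invfM mulrDr mulr1 mulrCA mulfV ?mulr1.
exact/funext.
Qed.

End EntireSeries.

Section AnalyticFunctions.
Context {R : realType}.
Implicit Types (g : 'rV[R]_2 -> R) (p h : 'rV[R]_2).

Lemma eq_analytic_at g1 g2 p :
  (forall q, g1 q = g2 q) -> analytic_at g1 p -> analytic_at g2 p.
Proof. by move=> /funext ->. Qed.

Lemma analytic_at_cst (c : R) p : analytic_at (fun=> c) p.
Proof. exact: (analytic_at_coord0 _ p (power_series_cst c)). Qed.

Lemma analytic_at_r p : analytic_at (fun q => q 0 0) p.
Proof.
apply: eq_analytic_at (analytic_atD _ _ _ (analytic_at_cst (p 0 0) p)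
  (analytic_at_coord0 _ p power_series_id)).
by move=> q; rewrite addrC subrK.
Qed.

Lemma analytic_at_s p : analytic_at (fun q => q 0 1) p.
Proof.
apply: eq_analytic_at (analytic_atD _ _ _ (analytic_at_cst (p 0 1) p)
  (analytic_at_coord1 _ p power_series_id)).
by move=> q; rewrite addrC subrK.
Qed.

Lemma analytic_atZ g c p : analytic_at g p -> analytic_at (fun q => c * g q) p.
Proof. exact: analytic_atM (analytic_at_cst c p). Qed.

Lemma analytic_atB g1 g2 p : analytic_at g1 p -> analytic_at g2 p ->
  analytic_at (fun q => g1 q - g2 q) p.
Proof.
move=> a1 /(analytic_atZ _ (-1)) a2.
apply: eq_analytic_at (analytic_atD _ _ _ a1 a2).
by move=> q; rewrite mulN1r.
Qed.

Lemma analytic_atX g n p : analytic_at g p -> analytic_at (fun q => g q ^+ n) p.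
Proof.
move=> ag; elim: n => [|n IH].
  by apply: eq_analytic_at (analytic_at_cst 1 p); move=> q; rewrite expr0.
apply: eq_analytic_at (analytic_atM _ _ _ ag IH).
by move=> q; rewrite exprS.
Qed.

(** With [u = q0 - p0] and [v = q1 - p1], the argument is a constant plus
    [k p1 u + k p0 v + k u v]; the addition formulas reduce the claim to power
    series in [u], in [v] and in [u v]. *)
Lemma analytic_at_cos_prod (k c : R) p :
  analytic_at (fun q => cos (k * (q 0 0 * q 0 1) + c)) p.
Proof.
pose cos_at (w : 'rV[R]_2 -> R) := analytic_at (fun q => cos (w q)) p.
pose sin_at (w : 'rV[R]_2 -> R) := analytic_at (fun q => sin (w q)) p.
have addA w1 w2 : cos_at w1 /\ sin_at w1 -> cos_at w2 /\ sin_at w2 ->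
    cos_at (fun q => w1 q + w2 q) /\ sin_at (fun q => w1 q + w2 q).
  move=> [c1 s1] [c2 s2]; split.
    apply: eq_analytic_at
      (analytic_atB _ _ _ (analytic_atM _ _ _ c1 c2) (analytic_atM _ _ _ s1 s2)).
    by move=> q; rewrite cosD.
  apply: eq_analytic_at
    (analytic_atD _ _ _ (analytic_atM _ _ _ s1 c2) (analytic_atM _ _ _ c1 s2)).
  by move=> q; rewrite sinD.
have a0 x : cos_at (fun=> x) /\ sin_at (fun=> x) by split; exact: analytic_at_cst.
have a1 x : cos_at (fun q => x * (q 0 0 - p 0 0)) /\ sin_at (fun q => x * (q 0 0 - p 0 0)).
  split; first exact: (analytic_at_coord0 _ p (power_series_scale _ x power_series_cos)).
  exact: (analytic_at_coord0 _ p (power_series_scale _ x power_series_sin)).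
have a2 x : cos_at (fun q => x * (q 0 1 - p 0 1)) /\ sin_at (fun q => x * (q 0 1 - p 0 1)).
  split; first exact: (analytic_at_coord1 _ p (power_series_scale _ x power_series_cos)).
  exact: (analytic_at_coord1 _ p (power_series_scale _ x power_series_sin)).
have a3 : cos_at (fun q => k * ((q 0 0 - p 0 0) * (q 0 1 - p 0 1))) /\
          sin_at (fun q => k * ((q 0 0 - p 0 0) * (q 0 1 - p 0 1))).
  split; first exact: (analytic_at_coord01 _ p (power_series_scale _ k power_series_cos)).
  exact: (analytic_at_coord01 _ p (power_series_scale _ k power_series_sin)).
have [+ _] := addA _ _ (addA _ _ (addA _ _ a3 (a1 (k * p 0 1))) (a2 (k * p 0 0)))
  (a0 (k * (p 0 0 * p 0 1) + c)).
apply: eq_analytic_at => q; congr (cos _); ring.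
Qed.

Lemma analytic_at_sin_prod (k c : R) p :
  analytic_at (fun q => sin (k * (q 0 0 * q 0 1) + c)) p.
Proof.
apply: eq_analytic_at (analytic_at_cos_prod k (c - pi / 2) p).
by move=> q; rewrite addrA cosBpihalf.
Qed.

Lemma analytic_at_invr p : p 0 0 != 0 -> analytic_at (fun q => (q 0 0)^-1) p.
Proof.
move=> p0; apply: eq_analytic_at
  (analytic_at_coord0 _ p (power_series_inv (p 0 0) p0)).
by move=> q; rewrite addrC subrK.
Qed.

Lemma near_coord_neq0 p j : p 0 j != 0 -> \forall q \near p, (q : 'rV[R]_2) 0 j != 0.
Proof.
move=> pj; have c : (fun q : 'rV[R]_2 => q 0 j) @ p --> p 0 j by exact: coord_continuous.
by apply: (c [set x | x != 0]); apply: open_nbhs_nbhs; split=> //; exact: open_neq.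
Qed.

(** Off the line [q0 = 0] this is [sin (k q0 q1) / q0]. At a point [(0, p1)], with
    [u = q0] and [v = q1 - p1], expand [sin (k u (p1 + v))] by the addition
    formula and divide each term by [u]. *)
Lemma analytic_at_sinc_prod (k : R) p :
  analytic_at (fun q => k * q 0 1 * sinc (k * (q 0 0 * q 0 1))) p.
Proof.
have sincE (q : 'rV[R]_2) : q 0 0 != 0 ->
    k * q 0 1 * sinc (k * (q 0 0 * q 0 1)) = sin (k * (q 0 0 * q 0 1)) / q 0 0.
  by move=> q0; rewrite -mul_sinc; field.
have [p0|p0] := eqVneq (p 0 0) 0; last first.
  apply: near_eq_analytic_at
    (analytic_atM _ _ _ (analytic_at_sin_prod k 0 p) (analytic_at_invr _ p0)).
  by near=> q; rewrite addr0 sincE //; near: q; exact: near_coord_neq0.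
have s1 := analytic_at_coord0 _ p (power_series_scale _ (k * p 0 1) power_series_sinc).
have c1 := analytic_at_coord0 _ p (power_series_scale _ (k * p 0 1) power_series_cos).
have s2 := analytic_at_coord01 _ p (power_series_scale _ k power_series_sinc).
have c2 := analytic_at_coord01 _ p (power_series_scale _ k power_series_cos).
have v := analytic_at_coord1 _ p power_series_id.
have := analytic_atD _ _ _
  (analytic_atZ _ (k * p 0 1) _ (analytic_atM _ _ _ s1 c2))
  (analytic_atM _ _ _ c1 (analytic_atZ _ k _ (analytic_atM _ _ _ v s2))).
apply: eq_analytic_at => q; rewrite p0 subr0.
have [->|q0] := eqVneq (q 0 0) 0.
  by rewrite !(mul0r, mulr0) !sinc0 cos0; ring.
apply: (mulfI q0); rewrite sincE // [RHS]mulrC divfK //.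
rewrite (_ : k * (q 0 0 * q 0 1) = k * p 0 1 * q 0 0 + k * (q 0 0 * (q 0 1 - p 0 1))).
  by rewrite sinD -!mul_sinc; ring.
ring.
Unshelve. all: by end_near. Qed.

End AnalyticFunctions.

(** * Differentiability of analytic functions *)

Section AnalyticDifferentiable.
Context {R : realType}.

Lemma differentiable_quadratic {V : normedModType R} (f : V -> R) (x : V) (K d : R) :
  0 < d -> (forall h, `|h| < d -> `|f (h + x) - f x| <= K * `|h| ^+ 2) ->
  differentiable f x.
Proof.
move=> d0 fK; have fo : f \o shift x = cst (f x) + (\0 : V -> R) +o_ 0 id.
  apply/eqaddoP => _ /posnumP[e]; have K1 : 0 < `|K| + 1 by rewrite ltr_wpDl.
  apply/nbhs_normP; exists (Num.min d (e%:num / (`|K| + 1))) => /=.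
    by rewrite lt_min d0 divr_gt0.
  move=> h; rewrite /ball_ /= sub0r normrN lt_min => /andP[hd he].
  have -> : (f \o shift x - (cst (f x) + \0)) h = f (h + x) - f x.
    by rewrite !fctE /= addr0.
  apply: le_trans (fK _ hd) _; rewrite expr2 mulrA ler_wpM2r //.
  apply: le_trans (_ : (`|K| + 1) * `|h| <= _).
    by rewrite ler_wpM2r // (le_trans (ler_norm K)) // lerDl.
  by rewrite mulrC -ler_pdivlMr // ltW.
have dE : 'd f x = (\0 : V -> R) :> (V -> R).
  by apply: diff_unique fo => y; exact: cst_continuous.
by apply/diff_locallyP; rewrite dE; split=> // y; exact: cst_continuous.
Qed.

(** The terms of degree at most one are the differential. On [|h| <= rho] the sum
    of the terms of degree [n >= 2] is at most [(|h| / rho)^2] times its value at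
    [(rho, rho)], so the remainder is quadratic. *)
Lemma analytic_at_differentiable (g : 'rV[R]_2 -> R) (p : 'rV[R]_2) :
  analytic_at g p -> differentiable g p.
Proof.
move=> [a [e [e0 ga]]].
pose P (h : 'rV[R]_2) n : R := diag n (fun i j => a i j * h 0 0 ^+ i * h 0 1 ^+ j).
pose L (q : 'rV[R]_2) : R :=
  a 0%N 0%N + a 1%N 0%N * (q 0 0 - p 0 0) + a 0%N 1%N * (q 0 1 - p 0 1).
have Lp (h : 'rV[R]_2) : L (h + p) = P h 0%N + P h 1%N.
  rewrite /L /P /diag !big_ord_recl !big_ord0 /= !mxE !addrK.
  by rewrite /bump /= !addr0 !expr0 !expr1 !mulr1; ring.
have [rho rho0 rho_lt] : exists2 rho, 0 < rho & rho < e.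
  by exists (e / 2); rewrite ?divr_gt0 // ltr_pdivrMr // ltr_pMr // ltr1n.
pose w : 'rV[R]_2 := const_mx rho.
have w_lt : `|w| < e by apply: row_norm_lt => // j; rewrite mxE ger0_norm // ltW.
pose T n : R := diag n (fun i j => `|a i j * w 0 0 ^+ i * w 0 1 ^+ j|).
have [cT _] : cvgn (series T) /\ _ := ga w w_lt.
pose K := limn (series T).
have T0 n : 0 <= T n by apply: sumr_ge0.
have T_le N : series T N <= K.
  by apply: nondecreasing_cvgn_le => //; apply: nondecreasing_series => n _ _.
have P_le h n : `|h| <= rho -> (2 <= n)%N -> `|P h n| <= (`|h| / rho) ^+ 2 * T n.
  move=> h_le n2; apply: le_trans (ler_norm_diag _ _) _.
  have x1 : `|h| / rho <= 1 by rewrite ler_pdivrMr // mul1r.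
  have x0 : 0 <= `|h| / rho by rewrite divr_ge0 // ltW.
  apply: (@le_trans _ _ ((`|h| / rho) ^+ n * T n)); last first.
    by rewrite ler_wpM2r //; apply: ler_wiXn2l.
  rewrite mulrC /T diag_mull; apply: ler_diag => i j <-.
  have -> : `|a i j * w 0 0 ^+ i * w 0 1 ^+ j| * (`|h| / rho) ^+ (i + j) =
      `|a i j| * `|h| ^+ i * `|h| ^+ j.
    rewrite !mxE !normrM !normrX (ger0_norm (ltW rho0)) !exprD !expr_div_n.
    have := expf_neq0 i (lt0r_neq0 rho0); have := expf_neq0 j (lt0r_neq0 rho0).
    move: (rho ^+ i) (rho ^+ j) (`|h| ^+ i) (`|h| ^+ j) => x y u v y_neq0 x_neq0.
    by field; rewrite y_neq0 x_neq0.
  rewrite !normrM !normrX; apply: ler_pM; rewrite ?mulr_ge0 ?exprn_ge0 //.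
    by rewrite ler_wpM2l // lerXn2r ?nnegrE // ler_coord_norm.
  by rewrite lerXn2r ?nnegrE // ler_coord_norm.
have rem_le h : `|h| < rho -> `|g (p + h) - (P h 0%N + P h 1%N)| <= K / rho ^+ 2 * `|h| ^+ 2.
  move=> h_lt; have gh : series (P h) @ \oo --> g (p + h) := (ga h (lt_trans h_lt rho_lt)).2.
  have cR : (fun N => `|series (P h) N - (P h 0%N + P h 1%N)|) @ \oo -->
      `|g (p + h) - (P h 0%N + P h 1%N)|.
    by apply: cvg_norm; apply: cvgB => //; exact: cvg_cst.
  rewrite -(cvg_lim _ cR) //; apply: limr_le; first by apply/cvg_ex; eexists; exact: cR.
  exists 2%N => // N /= N2; rewrite -(subnK N2) series_addn.
  have -> : series (P h) 2 = P h 0%N + P h 1%N by rewrite series_ord !big_ord_recl big_ord0 addr0.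
  rewrite addrAC subrr add0r.
  apply: le_trans (ler_norm_sum _ _ _) _.
  apply: (@le_trans _ _ (\sum_(2 <= n < N - 2 + 2) (`|h| / rho) ^+ 2 * T n)).
    by rewrite !big_nat; apply: ler_sum => n /andP[n2 _]; apply: P_le; rewrite ?ltW.
  rewrite -mulr_sumr.
  rewrite (_ : K / rho ^+ 2 * `|h| ^+ 2 = (`|h| / rho) ^+ 2 * K); last first.
    by rewrite expr_div_n; ring.
  have x0 : 0 <= `|h| / rho by rewrite divr_ge0 // ltW.
  apply: ler_wpM2l; first exact: exprn_ge0.
  apply: le_trans _ (T_le (N - 2 + 2)%N); rewrite series_addn lerDr.
  by rewrite /series; apply: sumr_ge0.
have -> : g = (fun q => L q) + (fun q => g q - L q).
  by apply/funext => q; rewrite !fctE addrC subrK.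
apply: differentiableD.
  by rewrite /L; do ?apply: differentiableD; do ?apply: differentiableM;
    do ?apply: differentiableB; try exact: differentiable_coord; exact: differentiable_cst.
apply: (differentiable_quadratic _ _ (K / rho ^+ 2) rho rho0) => h h_lt.
have gp : g p = L p.
  have := rem_le 0; rewrite normr0 expr0n mulr0 addr0 -Lp add0r.
  by move=> /(_ rho0); rewrite normr_le0 subr_eq0 => /eqP.
by rewrite gp subrr subr0 Lp [h + p]addrC; exact: rem_le.
Qed.

Lemma differentiable_rowP n (V : normedModType R) (F : V -> 'rV[R]_n) (x : V) :
  (forall j, differentiable (fun y => F y 0 j) x) -> differentiable F x.
Proof.
move=> dF; have -> : F = \sum_(j < n) (fun y => F y 0 j *: delta_mx 0 j).
  apply/funext => y; rewrite fct_sumE [LHS]row_sum_delta.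
  by apply: eq_bigr.
by apply: differentiable_sum => j; exact: differentiableZl.
Qed.

Lemma is_derive_coord n (F : 'rV[R]_2 -> 'rV[R]_n) (p v : 'rV[R]_2) j :
  differentiable F p ->
  is_derive (0 : R) 1 (fun t => F (t *: v + p) 0 j) ('d F p v 0 j).
Proof.
move=> dF; have dv := diff_derivable dF (v := v).
have dj : derivable (fun q => F q 0 j) p v by move/derivable_mxP: dv; apply.
have -> : 'd F p v 0 j = 'D_v (fun q => F q 0 j) p.
  by rewrite -(deriveE v dF) (derive_mx dv) mxE.
apply: DeriveDef; first exact: (derivable1P (fun q => F q 0 j) p v).1 dj.
rewrite /derive [X in lim (X @ _) = _](_ : _ = fun h : R =>
  h^-1 *: (((fun q => F q 0 j) \o shift p) (h *: v) - F p 0 j)) //.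
apply/funext => h /=.
by rewrite addr0 scale0r add0r [_%:A]mulr1.
Qed.

End AnalyticDifferentiable.

(** * Disjoint unions of plane regions as analytic surfaces *)

Section Patches.
Context {R : realType} (W : nat -> set 'rV[R]_2) (W_open : forall k, open (W k)).

(** The pairs [(k, q)] with [q] in [W k]: the disjoint union of the regions
    [W k], with the topology induced from the product of [nat] and the plane. *)
Definition patch_points : set (nat * 'rV[R]_2) := [set x | W x.1 x.2].

Definition patches : topologicalType := patch_points.

Definition patch_index (x : patches) : nat := (set_val x).1.
Definition patch_coord (x : patches) : 'rV[R]_2 := (set_val x).2.

Lemma patch_coordP x : W (patch_index x) (patch_coord x).
Proof. exact: (set_mem (valP x)). Qed.

Lemma nbhs_patchesP (x : patches) (A : set patches) : nbhs x A <->
  exists2 e : R, 0 < e & forall y, patch_index y = patch_index x ->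
    `|patch_coord x - patch_coord y| < e -> A y.
Proof.
split=> [|[e e0 eA]].
  rewrite nbhsE => -[U [[C oC CU] Ux] UA].
  have : nbhs (set_val x) C by apply: open_nbhs_nbhs; split=> //; rewrite -CU in Ux.
  case=> -[P Q] /= [Px /nbhs_ballP[e /= e0 eQ]] PQC.
  exists e => // y yx xy; apply: UA; rewrite -CU; apply: PQC; split=> /=.
    by rewrite -/(patch_index y) yx; exact: nbhs_singleton Px.
  by apply: eQ; rewrite -ball_normE.
have nz : nbhs (set_val x) [set z | z.1 = patch_index x /\ `|patch_coord x - z.2| < e].
  exists ([set patch_index x], ball (patch_coord x) e) => /=.
    by split; [exact/principal_filterP | exact: nbhsx_ballx].
  by move=> -[i q] /= [-> ]; rewrite -ball_normE.
move: nz; rewrite nbhsE => -[C [oC Cx] CS]; rewrite nbhsE.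
exists (set_val @^-1` C : set patches); first by split=> //; exists C.
by move=> y /CS[yx xy]; exact: eA.
Qed.

Lemma nbhs_patch_ball (x : patches) (e : R) : 0 < e ->
  nbhs x [set z | patch_index z = patch_index x /\ `|patch_coord x - patch_coord z| < e].
Proof. by move=> e0; apply/nbhs_patchesP; exists e. Qed.

Lemma patches_ext (x y : patches) :
  patch_index x = patch_index y -> patch_coord x = patch_coord y -> x = y.
Proof.
move=> ixy cxy; apply: val_inj; rewrite -!set_valE.
by rewrite (surjective_pairing (set_val x)) (surjective_pairing (set_val y)); congr pair.
Qed.

Lemma hausdorff_patches : hausdorff_space patches.
Proof.
move=> x y xy.
have near_y e : 0 < e -> patch_index x = patch_index y /\
    `|patch_coord x - patch_coord y| < e.
  move=> e0; have e2 : 0 < e / 2 by rewrite divr_gt0.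
  have [z [[zx xz] [zy yz]]] := xy _ _ (nbhs_patch_ball x _ e2) (nbhs_patch_ball y _ e2).
  split; first by rewrite -zx -zy.
  rewrite -(subrK (patch_coord z) (patch_coord x)) -addrA (splitr e).
  by apply: le_lt_trans (ler_normD _ _) _; apply: ltrD => //; rewrite distrC.
apply: patches_ext; first by have [] := near_y 1 ltr01.
apply/eqP; rewrite -subr_eq0 -normr_eq0 eq_le normr_ge0 andbT.
by apply/ler_addgt0Pr => e e0; rewrite add0r; have [_ /ltW] := near_y e e0.
Qed.

(** Boxes with rational centre and radius in each component. *)
Lemma second_countable_patches : @second_countable patches.
Proof.
pose U (t : nat * rat * rat * rat) : set patches := [set y | patch_index y = t.1.1.1 /\
  `|patch_coord y 0 0 - ratr t.1.1.2| < ratr t.2 /\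
  `|patch_coord y 0 1 - ratr t.1.2| < ratr t.2].
exists (range U).
  by apply: sub_countable (card_image_le _ _) _; exact: countableP.
split=> [_ [t _ <-]|x A /nbhs_patchesP[e e0 eA]].
  rewrite openE => y [yt [y0 y1]]; apply/nbhs_patchesP.
  exists (Num.min (ratr t.2 - `|patch_coord y 0 0 - ratr t.1.1.2|)
                  (ratr t.2 - `|patch_coord y 0 1 - ratr t.1.2|)).
    by rewrite lt_min !subr_gt0 y0.
  have aux z (j : 'I_2) (c : R) :
      `|patch_coord y - patch_coord z| < ratr t.2 - `|patch_coord y 0 j - c| ->
      `|patch_coord z 0 j - c| < ratr t.2.
    rewrite ltrBrDr; apply: le_lt_trans.
    rewrite -(subrK (patch_coord y 0 j) (patch_coord z 0 j)) -addrA.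
    apply: le_trans (ler_normD _ _) _; rewrite lerD2r distrC.
    by have := ler_coord_norm (patch_coord y - patch_coord z) j; rewrite !mxE.
  move=> z zy; rewrite lt_min => /andP[z0 z1]; split; first by rewrite zy.
  by split; exact: aux.
have [d /itvP d_in] : exists d : rat, ratr d \in `]0, e / 2[%R.
  by apply: rat_in_itvoo; rewrite divr_gt0.
have d0 : 0 < ratr d :> R by rewrite d_in.
have near_rat (c : R) : exists q : rat, `|c - ratr q| < ratr d.
  have [q /itvP q_in] : exists q : rat, ratr q \in `]c - ratr d, c + ratr d[%R.
    by apply: rat_in_itvoo; rewrite ltrD2l gtrN.
  by exists q; rewrite distrC ltr_distl !q_in.
have [q0 xq0] := near_rat (patch_coord x 0 0).
have [q1 xq1] := near_rat (patch_coord x 0 1).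
exists (U (patch_index x, q0, q1, d)); first by split; [exists (patch_index x, q0, q1, d) | split].
move=> y [/= yx [y0 y1]]; apply: eA => //.
have aux j (c : R) : `|patch_coord x 0 j - c| < ratr d -> `|patch_coord y 0 j - c| < ratr d ->
    `|(patch_coord x - patch_coord y) 0 j| < e.
  move=> xc yc; rewrite !mxE -(subrK c (patch_coord x 0 j)) -addrA.
  apply: le_lt_trans (ler_normD _ _) _; rewrite (splitr e).
  by apply: ltrD; [|rewrite distrC]; apply: lt_trans (_ : ratr d < _) => //; rewrite d_in.
by apply: row_norm_lt => //; apply: forall_ord2; [exact: aux xq0 y0 | exact: aux xq1 y1].
Qed.

(** Indexing the charts by points of the surface, rather than by components,
    provides the default value that the inverse chart takes off its domain, even
    if some components are empty. *)
Section Chart.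
Variable x : patches.

Definition patch_inv (q : 'rV[R]_2) : patches :=
  if pselect (W (patch_index x) q) is left Wq
  then SigSub (mem_set (Wq : patch_points (patch_index x, q))) else x.

Definition patch_dom : set patches := [set y | patch_index y = patch_index x].

Lemma patch_inv_index q : patch_index (patch_inv q) = patch_index x.
Proof. by rewrite /patch_inv; case: pselect. Qed.

Lemma patch_inv_coord q : W (patch_index x) q -> patch_coord (patch_inv q) = q.
Proof. by rewrite /patch_inv; case: pselect. Qed.

Lemma patch_image : patch_coord @` patch_dom = W (patch_index x).
Proof.
apply/seteqP; split=> [_ [y yx <-]|q Wq].
  by rewrite -yx; exact: patch_coordP.
by exists (patch_inv q); [exact: patch_inv_index | exact: patch_inv_coord].
Qed.

Lemma open_patch_dom : open patch_dom.
Proof.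
rewrite openE => y yx; apply/nbhs_patchesP; exists 1 => // z zy _.
by rewrite /patch_dom /= zy.
Qed.

Lemma patch_coordK y : patch_dom y -> patch_inv (patch_coord y) = y.
Proof.
move=> yx; apply: patches_ext; first by rewrite patch_inv_index yx.
by rewrite patch_inv_coord // -yx; exact: patch_coordP.
Qed.

Lemma patch_coord_continuous : {within patch_dom, continuous patch_coord}.
Proof.
apply: continuous_subspaceT => y A /nbhs_ballP[e /= e0 eA].
by apply/nbhs_patchesP; exists e => // z _ yz; apply: eA; rewrite -ball_normE.
Qed.

Lemma patch_inv_continuous : {within patch_coord @` patch_dom, continuous patch_inv}.
Proof.
rewrite patch_image continuous_open_subspace // => q /set_mem Wq A.
move=> /nbhs_patchesP[e e0 eA].
have near_W : nbhs q (W (patch_index x)) by apply: open_nbhs_nbhs.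
have near_e : nbhs q (ball q e) by exact: nbhsx_ballx.
apply: filterS (filterI near_W near_e) => z [Wz]; rewrite -ball_normE /= => qz.
by apply: eA; rewrite ?patch_inv_index // !patch_inv_coord.
Qed.

Lemma open_patch_cod : open (patch_coord @` patch_dom).
Proof. by rewrite patch_image. Qed.

Definition patch_chart : chart R patches :=
  Chart open_patch_dom open_patch_cod patch_coordK patch_coord_continuous
    patch_inv_continuous.

End Chart.

Lemma analytic_on_id (U : set 'rV[R]_2) (g : 'rV[R]_2 -> 'rV[R]_2) :
  open U -> (forall q, U q -> g q = q) -> analytic_on U g.
Proof.
move=> oU gid p Up j.
have : \forall q \near p, (q : 'rV[R]_2) 0 j = g q 0 j.
  by near=> q; rewrite gid //; near: q; exact: open_nbhs_nbhs.
move=> /near_eq_analytic_at; apply; move: j.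
by apply: forall_ord2; [exact: analytic_at_r | exact: analytic_at_s].
Unshelve. all: by end_near. Qed.

Lemma patch_atlas_cover (x : patches) :
  exists2 c, range patch_chart c & chart_dom c x.
Proof. by exists (patch_chart x); [exists x | ]. Qed.

Lemma patch_atlas_compatible c d : range patch_chart c -> range patch_chart d ->
  analytic_on (chart_map c @` (chart_dom c `&` chart_dom d)) (chart_map d \o chart_inv c).
Proof.
move=> [x _ <-] [y _ <-] /=.
have [xy|nxy] := pselect (patch_index x = patch_index y).
  rewrite (_ : patch_dom x `&` patch_dom y = patch_dom x); last first.
    by apply/seteqP; split=> [z []//|z zx]; split=> //; rewrite /patch_dom /= zx.
  rewrite patch_image; apply: analytic_on_id => // q Wq /=.
  exact: patch_inv_coord.
by move=> p [z [zx zy] _]; case: nxy; rewrite -zx -zy.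
Qed.

Definition patch_surface : analytic_surface R :=
  AnalyticSurface hausdorff_patches second_countable_patches patch_atlas_cover
    patch_atlas_compatible.

End Patches.

(** The surface is the disjoint union of the [W k]. Read in a chart, the resulting
    map agrees with some [F k] near each point, so analyticity and the trivial
    kernel of the differential pass from the [F k] to it. *)
Lemma immersed_union_of_patches (R : realType) (n : nat) (W : nat -> set 'rV[R]_2)
    (F : nat -> 'rV[R]_2 -> 'rV[R]_n) :
  (forall k, open (W k)) ->
  (forall k, analytic_on (W k) (F k)) ->
  (forall k p v, W k p -> 'd (F k) p v = 0 -> v = 0) ->
  exists (M : analytic_surface R) (f : M -> 'rV[R]_n),
    analytic_immersion f /\ range f = \bigcup_k F k @` W k.
Proof.
move=> oW aF iF.
pose f (x : patch_surface W oW) := F (patch_index W x) (patch_coord W x).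
exists (patch_surface W oW), f; split; last first.
  apply/seteqP; split=> [_ [x _ <-]|_ [k _ [q Wq <-]]].
    by exists (patch_index W x) => //; exists (patch_coord W x) => //; exact: patch_coordP.
  by exists (SigSub (mem_set (Wq : patch_points W (k, q)))).
move=> _ [x _ <-]; set k := patch_index W x.
rewrite (_ : chart_cod (patch_chart W oW x) = W k) /=; last exact: patch_image.
have near_f p : W k p -> \forall q \near p, F k q = (f \o patch_inv W x) q.
  move=> Wp; near=> q; rewrite /f /= patch_inv_index patch_inv_coord //.
  by near: q; exact: open_nbhs_nbhs.
have af : analytic_on (W k) (f \o patch_inv W x).
  move=> p Wp j; apply: near_eq_analytic_at (aF k p Wp j).
  by near=> q; rewrite (near (near_f p Wp) q).
split=> // p Wp v w /eqP; rewrite -subr_eq0 -linearB => /eqP dvw.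
apply: subr0_eq; apply: (iF k p _ Wp).
rewrite -deriveE; last by apply: differentiable_rowP => j; apply/analytic_at_differentiable/aF.
rewrite (near_eq_derive _ (near_f p Wp)) deriveE //.
by apply: differentiable_rowP => j; apply/analytic_at_differentiable/af.
Unshelve. all: by end_near. Qed.

(** * The catenoid in polar coordinates *)

Section Formulas.
Context {R : realType} (m : nat).
Local Notation mR := (m%:R : R).
Implicit Types r theta : R.

Lemma xplane_Re r theta : complex.Re (xplane m r theta) =
  (mR - 1) ^+ 2 / (4 * mR) * cos (mR * theta + theta)
  + (mR + 1) ^+ 2 / (4 * mR) * cos (mR * theta - theta)
  - (mR ^+ 2 - 1) / (4 * mR) * r ^+ m * cos theta.
Proof.
rewrite /xplane /gamma_m /cis /= cosN !mul0r !subr0.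
by rewrite [(_ + 1) * _]mulrDl [(_ - 1) * _]mulrBl !mul1r; ring.
Qed.

Lemma xplane_Im r theta : complex.Im (xplane m r theta) =
  (mR - 1) ^+ 2 / (4 * mR) * sin (mR * theta + theta)
  - (mR + 1) ^+ 2 / (4 * mR) * sin (mR * theta - theta)
  - (mR ^+ 2 - 1) / (4 * mR) * r ^+ m * sin theta.
Proof.
rewrite /xplane /gamma_m /cis /= sinN !mul0r !addr0.
by rewrite [(_ + 1) * _]mulrDl [(_ - 1) * _]mulrBl !mul1r; ring.
Qed.

Lemma gamma_mE theta : (0 < m)%N -> gamma_m m theta = xplane m (0 : R) theta.
Proof.
move=> m0; rewrite /xplane expr0n (gtn_eqF m0) mulr0.
by rewrite (_ : real_complex R 0 = 0) // mulr0 subr0.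
Qed.

Lemma pointE (a b c d a' b' c' d' : R) :
  a = a' -> b = b' -> c = c' -> d = d' -> Defs.point a b c d = Defs.point a' b' c' d'.
Proof. by move=> -> -> -> ->. Qed.

Lemma cisX theta n : cis theta ^+ n = cis (n%:R * theta).
Proof.
elim: n => [|n IH]; first by rewrite expr0 mul0r /cis cos0 sin0.
rewrite exprS IH -natr1 mulrDl mul1r /cis cosD sinD.
by apply/eqP; rewrite eq_complex /=; apply/andP; split; apply/eqP; ring.
Qed.

Lemma normc_cis theta : `|cis theta| = 1.
Proof. by rewrite normc_def /= cos2Dsin2 sqrtr1. Qed.

End Formulas.

Section Polar.
Context {R : realType} (m : nat).
Local Notation mR := (m%:R : R).
Local Notation mC := (m%:R : R[i]).
Local Open Scope complex_scope.

Lemma hermitian_entry (M : 'M[R[i]]_2) (s : R[i]) i j :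
  ((s *: M) *m e3 R *m (map_mx Num.conj (s *: M)^T)) i j =
  `|s| ^+ 2 * (M i 0 * Num.conj (M j 0) - M i 1 * Num.conj (M j 1)).
Proof.
rewrite normCK !mxE !big_ord_recl !big_ord0 !mxE !big_ord_recl !big_ord0 !mxE /=.
rewrite !rmorphM /= (_ : lift ord0 ord0 = 1 :> 'I_2); last exact: val_inj.
rewrite (_ : ord0 = 0 :> 'I_2) //; ring.
Qed.

Hypothesis m_ge2 : (2 <= m)%N.

Lemma mR_gt1 : 1 < mR. Proof. by rewrite ltr1n. Qed.

Lemma mR_neq : [/\ mR != 0, mR - 1 != 0 & mR + 1 != 0].
Proof. by have := mR_gt1 => m1; split; apply: lt0r_neq0; lra. Qed.

(** Only [|s|^2] of the scalar factor [s] of [F_I] enters, so the choice of the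
    square root does not matter; after the trigonometric identities each
    coordinate is an identity of rational functions. *)
Lemma f_I_polarE (p : R * R) : 0 < p.1 -> f_I_polar m p = f_I_ext m p.
Proof.
case: p => r theta /= r_gt0; have [mR_neq0 mB_neq0 mD_neq0] := mR_neq.
have r_neq0 : r != 0 by rewrite gt_eqF.
rewrite /f_I_ext xplane_Re xplane_Im /f_I_polar /f_I /F_I /=.
set z := r%:C * cis theta; set s := sqrtC z ^- m.+1 / (2 * sqrtC mC).
have norm_z : `|z| = r%:C.
  by rewrite normrM normc_cis mulr1 normc_def /= expr0n addr0 sqrtr_sqr gtr0_norm.
have norm_s : `|s| ^+ 2 = (r ^- m.+1 / (4 * mR))%:C.
  rewrite /s normrM normfV normrX normfV normrM exprMn !exprVn exprMn -!normrX.
  rewrite exprAC sqrtCK sqrtCK normrX norm_z normr_nat -natrX normr_nat.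
  by rewrite rmorphM /= !fmorphV rmorphXn rmorphM /= !rmorph_nat.
rewrite /point_of_hermitian !hermitian_entry norm_s /mat2 !mxE /=.
have zE : z = (r * cos theta) +i* (r * sin theta) by rewrite /z /cis; simpc.
have zmE : z ^+ m = (r ^+ m * cos (mR * theta)) +i* (r ^+ m * sin (mR * theta)).
  by rewrite /z exprMn cisX -rmorphXn /cis; simpc.
have mE : mC = mR%:C by rewrite rmorph_nat.
rewrite zmE zE mE /xplus /xminus /=.
rewrite cosD sinD cosB sinB exprSr invfM.
have := cos2Dsin2 theta; have := cos2Dsin2 (mR * theta).
have := expf_neq0 m r_neq0.
move: (cos theta) (sin theta) (cos (mR * theta)) (sin (mR * theta)) (r ^+ m)
  mR_neq0 mB_neq0 mD_neq0.
move: mR => k c1 s1 C S rho k0 kB kD rho0 CS cs.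
set c := (k ^+ 2 - 1) / (4 * k).
have e00 : r^-1 / rho / (4 * k) * (r ^+ 2 * (c1 ^+ 2 + s1 ^+ 2) *
    ((k + 1) ^+ 2 - ((k - 1) ^+ 2 * rho ^+ 2 * (C ^+ 2 + S ^+ 2)
      - 2 * (k - 1) * (k + 1) * rho * C + (k + 1) ^+ 2))) =
    c * r * (2 * C - (k - 1) / (k + 1) * rho).
  by rewrite CS cs /c; field; rewrite k0 kD rho0 r_neq0.
have e11 : r^-1 / rho / (4 * k) * ((k - 1) ^+ 2 -
    ((k + 1) ^+ 2 * rho ^+ 2 * (C ^+ 2 + S ^+ 2)
      - 2 * (k - 1) * (k + 1) * rho * C + (k - 1) ^+ 2)) =
    c * r^-1 * (2 * C - (k + 1) / (k - 1) * rho).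
  by rewrite CS /c; field; rewrite k0 kB rho0 r_neq0.
apply: pointE.
- by rewrite -e00 -e11; ring.
- transitivity (r^-1 / rho / (4 * k) * (r * rho * (
      (((k - 1) ^+ 2 + (k + 1) ^+ 2) * C - (k ^+ 2 - 1) * rho * (C ^+ 2 + S ^+ 2)) * c1 -
      ((k - 1) ^+ 2 - (k + 1) ^+ 2) * S * s1))); first by ring.
  by rewrite CS /c; field; rewrite k0 rho0 r_neq0.
- transitivity (r^-1 / rho / (4 * k) * (r * rho * (
      (((k - 1) ^+ 2 + (k + 1) ^+ 2) * C - (k ^+ 2 - 1) * rho * (C ^+ 2 + S ^+ 2)) * s1 +
      ((k - 1) ^+ 2 - (k + 1) ^+ 2) * S * c1))); first by ring.
  by rewrite CS /c; field; rewrite k0 rho0 r_neq0.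
- by rewrite -e00 -e11; ring.
Qed.
End Polar.

(** * The catenoid as the projection of a closed relation *)

Section Angles.
Context {R : realType}.
Implicit Types theta phi x : R.

Lemma cis_inj_trig theta phi : cis theta = cis phi ->
  cos theta = cos phi /\ sin theta = sin phi.
Proof. by move=> [-> ->]. Qed.

Lemma eq_cis_mul n theta phi : cis theta = cis phi ->
  cos (n%:R * theta) = cos (n%:R * phi) /\ sin (n%:R * theta) = sin (n%:R * phi).
Proof. by move=> e; apply: cis_inj_trig; rewrite -!cisX e. Qed.

Lemma cis_representative theta :
  exists2 phi, 0 <= phi < pi *+ 2 & cis phi = cis theta.
Proof.
have cos_in : -1 <= cos theta <= 1 by rewrite cos_geN1 cos_le1.
have acosE : cos (acos (cos theta)) = cos theta.
  by apply: acosK; rewrite in_itv.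
have sinE : sin (acos (cos theta)) = `|sin theta|.
  by rewrite sin_acos // -sin2cos2 sqrtr_sqr.
have pi0 := pi_gt0 R; have ge0 := acos_ge0 cos_in; have lepi := acos_lepi cos_in.
have [s_ge0|s_lt0] := leP 0 (sin theta).
  exists (acos (cos theta)); last by rewrite /cis acosE sinE ger0_norm.
  by rewrite ge0 /= mulr2n (le_lt_trans lepi) // ltrDl.
exists (pi *+ 2 - acos (cos theta)); last first.
  rewrite /cis cosB sinB cos2pi sin2pi acosE sinE ltr0_norm //.
  by rewrite !mul0r !mul1r addr0 sub0r opprK.
have gt0 : 0 < acos (cos theta).
  apply: acos_gt0; rewrite cos_geN1 lt_neqAle cos_le1 andbT /=.
  apply/eqP => c1; have := cos2Dsin2 theta; rewrite c1 expr1n => /eqP.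
  by rewrite -subr_eq0 addrAC subrr add0r sqrf_eq0 (lt_eqF s_lt0).
by rewrite mulr2n; lra.
Qed.

Lemma cos_eq0_lt n x : 0 <= x < n%:R * pi -> cos x = 0 ->
  exists2 k, (k < n)%N & x = (2 * k%:R + 1) / 2 * pi.
Proof.
have pi0 := pi_gt0 R.
elim: n x => [|n IH] x /andP[x0 xn] cx; first by rewrite mul0r in xn; lra.
have [x_lt|x_ge] := ltP x pi.
  exists 0%N => //; rewrite mulr0 add0r mul1r mulrC.
  apply: cos_inj; last by rewrite cos_pihalf.
    by rewrite in_itv /= x0 ltW.
  by rewrite in_itv /=; apply/andP; split; lra.
have [||k kn xk] := IH (x - pi).
- by rewrite -natr1 mulrDl mul1r in xn; apply/andP; split; lra.
- by rewrite -[x](subrK pi) cosDpi in cx; apply/eqP; rewrite -oppr_eq0 cx.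
by exists k.+1 => //; rewrite -(subrK pi x) xk -natr1; field.
Qed.

End Angles.

Section Graph.
Context {R : realType} (m : nat) (m_ge2 : (2 <= m)%N).
Local Notation mR := (m%:R : R).
Local Notation amp := ((mR ^+ 2 - 1) / (4 * mR)).
Implicit Types (p : R * R) (X Y : 'rV[R]_4).

Lemma pointK (t x y z : R) : [/\ Defs.point t x y z 0 0 = t, Defs.point t x y z 0 1 = x,
  Defs.point t x y z 0 2%:R = y & Defs.point t x y z 0 3%:R = z].
Proof. by split; rewrite mxE. Qed.

Lemma row4P (X Y : 'rV[R]_4) : X 0 0 = Y 0 0 -> X 0 1 = Y 0 1 -> X 0 2%:R = Y 0 2%:R ->
  X 0 3%:R = Y 0 3%:R -> X = Y.
Proof.
by move=> e0 e1 e2 e3; apply/rowP; apply: forall_ord4.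
Qed.

(** The equations [X = f_I_ext m (r, theta)] with the denominator [r] of
    [x_0 - x_3] cleared. They still make sense at [r = 0], where they force
    [cos (m theta) = 0] and describe the light-like lines. *)
Definition on_graph p X : Prop :=
  [/\ X 0 0 + X 0 3%:R = xplus m p.1 p.2,
      p.1 * (X 0 0 - X 0 3%:R) =
        amp * (2 * cos (mR * p.2) - (mR + 1) / (mR - 1) * p.1 ^+ m),
      X 0 1 = complex.Re (xplane m p.1 p.2)
    & X 0 2%:R = complex.Im (xplane m p.1 p.2)].

Lemma mul_xminus (r theta : R) : r != 0 -> r * xminus m r theta =
  amp * (2 * cos (mR * theta) - (mR + 1) / (mR - 1) * r ^+ m).
Proof. by move=> r0; rewrite /xminus -[_ * r^-1 * _]mulrA mulrCA mulVKf. Qed.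

Lemma on_graph_f_I_ext p X : p.1 != 0 -> on_graph p X <-> X = f_I_ext m p.
Proof.
move=> r0; split=> [[e1 e2 e3 e4]|->]; last first.
  have [g0 g1 g2 g3] := pointK ((xplus m p.1 p.2 + xminus m p.1 p.2) / 2)
    (complex.Re (xplane m p.1 p.2)) (complex.Im (xplane m p.1 p.2))
    ((xplus m p.1 p.2 - xminus m p.1 p.2) / 2).
  rewrite /on_graph /f_I_ext g0 g1 g2 g3 -mul_xminus //; split=> //; by field.
have e2' : X 0 0 - X 0 3%:R = xminus m p.1 p.2.
  by apply: (mulfI r0); rewrite mul_xminus // -e2.
have [g0 g1 g2 g3] := pointK ((xplus m p.1 p.2 + xminus m p.1 p.2) / 2)
  (complex.Re (xplane m p.1 p.2)) (complex.Im (xplane m p.1 p.2))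
  ((xplus m p.1 p.2 - xminus m p.1 p.2) / 2).
by apply: row4P; rewrite /f_I_ext ?g0 ?g1 ?g2 ?g3 // -e1 -e2'; field.
Qed.

Lemma eq_cis_xplane (r theta phi : R) : cis theta = cis phi ->
  complex.Re (xplane m r theta) = complex.Re (xplane m r phi) /\
  complex.Im (xplane m r theta) = complex.Im (xplane m r phi).
Proof.
move=> e; have [c1 s1] := cis_inj_trig _ _ e; have [cm sm] := eq_cis_mul m _ _ e.
by rewrite !xplane_Re !xplane_Im !(cosD, sinD, sinN, cosN) c1 s1 cm sm.
Qed.

Lemma on_graph_cis (r theta phi : R) X : cis theta = cis phi ->
  on_graph (r, theta) X -> on_graph (r, phi) X.
Proof.
move=> e; have [cm _] := eq_cis_mul m _ _ e; have [re im] := eq_cis_xplane r _ _ e.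
by rewrite /on_graph /xplus re im /= cm.
Qed.

(** Multiplying the first two equations gives [(x_0 + x_3) (x_0 - x_3)] without
    the denominator, so [r = 0] needs no separate argument. *)
Lemma on_graph_deSitter p X : on_graph p X -> deSitter X.
Proof.
move=> [e1 e2 e3 e4]; have [m0 mB mD] := mR_neq (R := R) _ m_ge2; rewrite /deSitter /lorentz /=.
rewrite e3 e4 xplane_Re xplane_Im cosD sinD cosB sinB.
have -> : - (X 0 0 * X 0 0) = - ((X 0 0 + X 0 3%:R) * (X 0 0 - X 0 3%:R)) - X 0 3%:R * X 0 3%:R.
  ring.
rewrite e1 /xplus.
set C := cos (mR * p.2); set S := sin (mR * p.2).
have -> : amp * p.1 * (2 * C - (mR - 1) / (mR + 1) * p.1 ^+ m) * (X 0 0 - X 0 3%:R) =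
    amp * (2 * C - (mR - 1) / (mR + 1) * p.1 ^+ m) * (p.1 * (X 0 0 - X 0 3%:R)) by ring.
rewrite e2 -/C; have := cos2Dsin2 p.2; have := cos2Dsin2 (mR * p.2); rewrite -/C -/S.
move: mR m0 mB mD C S (cos p.2) (sin p.2) (p.1 ^+ m) => k k0 kB kD C S c1 s1 rho CS cs.
have S2 : S ^+ 2 = 1 - C ^+ 2 by rewrite -CS addrC addKr.
transitivity (- ((k ^+ 2 - 1) / (4 * k)) ^+ 2 * (2 * C - (k - 1) / (k + 1) * rho)
    * (2 * C - (k + 1) / (k - 1) * rho) +
  (c1 ^+ 2 + s1 ^+ 2) * (((k ^+ 2 + 1) / (2 * k) * C - (k ^+ 2 - 1) / (4 * k) * rho) ^+ 2
    + S ^+ 2)).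
  by field; rewrite k0 kB kD.
by rewrite cs S2; field; rewrite k0 kB kD.
Qed.

Lemma mul_alpha k : mR * alpha R m k = (2 * k%:R + 1) / 2 * pi.
Proof. by have [m0 _ _] := mR_neq (R := R) _ m_ge2; rewrite /alpha; field. Qed.

Lemma cos_alpha k : cos (mR * alpha R m k) = 0.
Proof.
rewrite mul_alpha; elim: k => [|k IH].
  by rewrite mulr0 add0r mul1r mulrC cos_pihalf.
rewrite (_ : (_ * pi) = (2 * k%:R + 1) / 2 * pi + pi); last by rewrite -natr1; field.
by rewrite cosDpi IH oppr0.
Qed.

Lemma sqr_sin_alpha k : sin (mR * alpha R m k) ^+ 2 = 1.
Proof. by rewrite sin2cos2 cos_alpha expr0n subr0. Qed.

Lemma sin_alpha_neq0 k : sin (mR * alpha R m k) != 0.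
Proof. by rewrite -sqrf_eq0 sqr_sin_alpha oner_eq0. Qed.

Lemma cos_mul_eq0 theta : cos (mR * theta) = 0 ->
  exists2 k, (k < 2 * m)%N & cis theta = cis (alpha R m k).
Proof.
have [m0 _ _] := mR_neq (R := R) _ m_ge2; have m1 := mR_gt1 (R := R) _ m_ge2.
have [phi /andP[phi0 phi_lt] e] := cis_representative theta.
have [-> _] := eq_cis_mul m _ _ (esym e) => /(cos_eq0_lt (2 * m)) [].
  rewrite mulr_ge0 //= natrM (_ : 2%:R * mR * pi = mR * (pi *+ 2)); last by rewrite mulr2n; ring.
  by rewrite ltr_pM2l //; lra.
move=> k k_lt mphi; exists k => //; rewrite -e; congr cis.
by apply: (mulfI m0); rewrite mul_alpha.
Qed.

Lemma amp_gt0 : 0 < amp.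
Proof.
have m1 := mR_gt1 (R := R) _ m_ge2; rewrite divr_gt0 ?mulr_gt0 //; last lra.
by rewrite subr_gt0 exprn_egt1.
Qed.

Lemma expr0m1 : (0 : R) ^+ m.-1 = 0.
Proof. by rewrite expr0n -subn1 subn_eq0 leqNgt m_ge2. Qed.

Lemma expr0m : (0 : R) ^+ m = 0.
Proof. by rewrite expr0n gtn_eqF // ltnW. Qed.

Lemma on_graph0_cos theta X : on_graph (0, theta) X -> cos (mR * theta) = 0.
Proof.
move=> [_ /= + _ _]; rewrite mul0r expr0m mulr0 subr0 => /esym/eqP.
by rewrite mulf_eq0 (gt_eqF amp_gt0) mulf_eq0 pnatr_eq0 /= => /eqP.
Qed.

Lemma lightline_on_graph k X : @lightline R m k X -> on_graph (0, alpha R m k) X.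
Proof.
have m_gt0 : (0 < m)%N by apply: leq_trans m_ge2.
move=> [t _ <-]; rewrite /on_graph /xplus gamma_mE //.
have [-> -> -> ->] := pointK t (complex.Re (xplane m 0 (alpha R m k)))
  (complex.Im (xplane m 0 (alpha R m k))) (- t).
by split=> //=; rewrite ?cos_alpha ?expr0m !(mulr0, mul0r, subr0) ?subrr.
Qed.

Lemma on_graph_lightline theta X : on_graph (0, theta) X ->
  exists2 k, (k < 2 * m)%N & @lightline R m k X.
Proof.
have m_gt0 : (0 < m)%N by apply: leq_trans m_ge2.
move=> gX; have [k k_lt e] := cos_mul_eq0 _ (on_graph0_cos _ _ gX).
have [e0 _ e1 e2] := on_graph_cis _ _ _ _ e gX.
exists k => //; exists (X 0 0) => //; rewrite gamma_mE //.
have [g0 g1 g2 g3] := pointK (X 0 0) (complex.Re (xplane m 0 (alpha R m k)))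
  (complex.Im (xplane m 0 (alpha R m k))) (- X 0 0).
apply: row4P; rewrite ?g0 ?g1 ?g2 ?g3 //.
by apply/eqP; rewrite eq_sym -addr_eq0 addrC e0 /xplus /= mulr0 mul0r.
Qed.

Definition graph (D : set R) : set 'rV[R]_4 :=
  [set X | exists2 p : R * R, D p.1 & on_graph p X].

Lemma graph_f_I_ext (D : set (R * R)) (E : set R) :
  (forall p, E p.1 <-> p.1 = 0 \/ D p) -> (forall p, D p -> p.1 != 0) -> E 0 ->
  graph E = @f_I_ext R m @` D `|` \bigcup_(k in `I_(2 * m)%N) @lightline R m k.
Proof.
move=> ED D0 E0; apply/seteqP; split=> [X [p Ep gX]|X [[p Dp <-]|[k k_lt lX]]].
- have [p0|p0] := eqVneq p.1 0.
    have [|k k_lt lX] := on_graph_lightline p.2 X; last by right; exists k.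
    by rewrite -p0 -surjective_pairing.
  left; exists p; last by apply/esym/on_graph_f_I_ext.
  by have /ED[/eqP|//] := Ep; rewrite (negbTE p0).
- exists p; first by apply/ED; right.
  by apply/on_graph_f_I_ext => //; exact: D0.
- by exists (0, alpha R m k) => //; exact: lightline_on_graph.
Qed.

Lemma catenoid_IE : @catenoid_I R m = graph setT.
Proof.
rewrite (graph_f_I_ext (@Omega R)) // => p; split=> // _.
by case: (eqVneq p.1 0) => [->|p0]; [left | right].
Qed.

Lemma graph_ge0E : graph [set r | 0 <= r] =
  @f_I_ext R m @` @Omega_pos R `|` \bigcup_(k in `I_(2 * m)%N) @lightline R m k.
Proof.
apply: graph_f_I_ext => [p|p|] /=; last exact: lexx.
  by rewrite le_eqVlt; split=> [/orP[/eqP|]|[->|->]]; rewrite ?eqxx ?orbT //; [left|right].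
by move=> /lt0r_neq0.
Qed.

End Graph.

(** * Analytic parametrizations across the light-like lines *)

Section PatchMap.
Context {R : realType} (m : nat) (m_ge2 : (2 <= m)%N).
Local Notation mR := (m%:R : R).
Local Notation amp := ((mR ^+ 2 - 1) / (4 * mR)).
Local Notation alpha := (alpha R m).
Implicit Types (q p v : 'rV[R]_2) (k : nat).

Definition patch_angle k q : R := alpha k + q 0 0 * q 0 1.

(** The value of [x_0 - x_3] after the substitution [theta = alpha_k + r s]: since
    [cos (m alpha_k) = 0], the term [2 cos (m theta) / r] equals
    [- 2 sin (m alpha_k) sin (m r s) / r], which is regular at [r = 0]. *)
Definition patch_xminus k q : R :=
  amp * (- (2 * sin (mR * alpha k)) * (mR * q 0 1 * sinc (mR * (q 0 0 * q 0 1)))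
        - (mR + 1) / (mR - 1) * q 0 0 ^+ m.-1).

(** A parametrization by [(r, s)] that covers all points with [r <> 0] and, at
    [r = 0], the line [L_k]. *)
Definition patch_map k q : 'rV[R]_4 :=
  let xp := xplus m (q 0 0) (patch_angle k q) in
  let xy := xplane m (q 0 0) (patch_angle k q) in
  Defs.point ((xp + patch_xminus k q) / 2) (complex.Re xy) (complex.Im xy)
    ((xp - patch_xminus k q) / 2).

Lemma patch_mapK k q : [/\
  patch_map k q 0 0 = (xplus m (q 0 0) (patch_angle k q) + patch_xminus k q) / 2,
  patch_map k q 0 1 = complex.Re (xplane m (q 0 0) (patch_angle k q)),
  patch_map k q 0 2%:R = complex.Im (xplane m (q 0 0) (patch_angle k q)) &
  patch_map k q 0 3%:R = (xplus m (q 0 0) (patch_angle k q) - patch_xminus k q) / 2].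
Proof. exact: pointK. Qed.

Lemma mul_patch_xminus k q : q 0 0 * patch_xminus k q =
  amp * (2 * cos (mR * patch_angle k q) - (mR + 1) / (mR - 1) * q 0 0 ^+ m).
Proof.
rewrite /patch_xminus /patch_angle [mR * (alpha k + _)]mulrDr cosD cos_alpha // mul0r sub0r.
rewrite (_ : mR * (q 0 0 * q 0 1) = (mR * q 0 1) * q 0 0); last ring.
have -> : sin (mR * q 0 1 * q 0 0) = q 0 0 * (mR * q 0 1 * sinc (mR * q 0 1 * q 0 0)).
  by rewrite -mul_sinc; ring.
have -> : q 0 0 ^+ m = q 0 0 * q 0 0 ^+ m.-1.
  by rewrite -exprS prednK // (leq_trans _ m_ge2).
ring.
Qed.

Lemma patch_on_graph k q : on_graph m (q 0 0, patch_angle k q) (patch_map k q).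
Proof.
have [e0 e1 e2 e3] := patch_mapK k q.
rewrite /on_graph e0 e1 e2 e3 -mul_patch_xminus.
by split=> //; rewrite ?[(_, _).1]/=; field.
Qed.

Lemma analytic_at_cos_angle (c : R) k p :
  analytic_at (fun q => cos (c * patch_angle k q)) p.
Proof.
apply: eq_analytic_at (analytic_at_cos_prod c (c * alpha k) p) => q.
by rewrite /patch_angle mulrDr addrC.
Qed.

Lemma analytic_at_sin_angle (c : R) k p :
  analytic_at (fun q => sin (c * patch_angle k q)) p.
Proof.
apply: eq_analytic_at (analytic_at_sin_prod c (c * alpha k) p) => q.
by rewrite /patch_angle mulrDr addrC.
Qed.

Lemma analytic_patch_map k (U : set 'rV[R]_2) : analytic_on U (patch_map k).
Proof.
move=> p _.
have a_r n := analytic_atX _ n _ (analytic_at_r p).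
have a_cos c := analytic_at_cos_angle c k p.
have a_sin c := analytic_at_sin_angle c k p.
have a_xp : analytic_at (fun q => xplus m (q 0 0) (patch_angle k q)) p.
  rewrite /xplus; apply: analytic_atM; first by apply: analytic_atZ; exact: analytic_at_r.
  by apply: analytic_atB; apply: analytic_atZ.
have a_xm : analytic_at (patch_xminus k) p.
  apply: analytic_atZ; apply: analytic_atB; apply: analytic_atZ => //.
  exact: analytic_at_sinc_prod.
have a_x1 : analytic_at (fun q => complex.Re (xplane m (q 0 0) (patch_angle k q))) p.
  apply: eq_analytic_at (analytic_atB _ _ _ (analytic_atD _ _ _
    (analytic_atZ _ ((mR - 1) ^+ 2 / (4 * mR)) _ (a_cos (mR + 1)))
    (analytic_atZ _ ((mR + 1) ^+ 2 / (4 * mR)) _ (a_cos (mR - 1))))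
    (analytic_atM _ _ _ (analytic_atZ _ amp _ (a_r m)) (a_cos 1))) => q.
  by rewrite xplane_Re [(_ + 1) * _]mulrDl [(_ - 1) * _]mulrBl !mul1r.
have a_x2 : analytic_at (fun q => complex.Im (xplane m (q 0 0) (patch_angle k q))) p.
  apply: eq_analytic_at (analytic_atB _ _ _ (analytic_atB _ _ _
    (analytic_atZ _ ((mR - 1) ^+ 2 / (4 * mR)) _ (a_sin (mR + 1)))
    (analytic_atZ _ ((mR + 1) ^+ 2 / (4 * mR)) _ (a_sin (mR - 1))))
    (analytic_atM _ _ _ (analytic_atZ _ amp _ (a_r m)) (a_sin 1))) => q.
  by rewrite xplane_Im [(_ + 1) * _]mulrDl [(_ - 1) * _]mulrBl !mul1r.
apply: forall_ord4.
- apply: eq_analytic_at (analytic_atZ _ 2^-1 _ (analytic_atD _ _ _ a_xp a_xm)) => q.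
  by have [-> _ _ _] := patch_mapK k q; rewrite mulrC.
- by apply: eq_analytic_at a_x1 => q; have [_ -> _ _] := patch_mapK k q.
- by apply: eq_analytic_at a_x2 => q; have [_ _ -> _] := patch_mapK k q.
- apply: eq_analytic_at (analytic_atZ _ 2^-1 _ (analytic_atB _ _ _ a_xp a_xm)) => q.
  by have [_ _ _ ->] := patch_mapK k q; rewrite mulrC.
Qed.

Lemma differentiable_patch_map k p : differentiable (patch_map k) p.
Proof.
by apply: differentiable_rowP => j; apply/analytic_at_differentiable/(analytic_patch_map k setT).
Qed.

Lemma patch_map_continuous k : continuous (patch_map k).
Proof. by move=> p; apply/differentiable_continuous/differentiable_patch_map. Qed.

Lemma is_derive_xplane (rho theta : R -> R) (dr w : R) :
  is_derive (0 : R) (1 : R) rho dr -> is_derive (0 : R) (1 : R) theta w ->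
  is_derive (0 : R) (1 : R) (fun t => complex.Re (xplane m (rho t) (theta t)))
   (- ((mR - 1) ^+ 2 / (4 * mR) * ((mR + 1) * w) * sin (mR * theta 0 + theta 0))
    - (mR + 1) ^+ 2 / (4 * mR) * ((mR - 1) * w) * sin (mR * theta 0 - theta 0)
    - amp * (mR * rho 0 ^+ m.-1 * dr * cos (theta 0) - rho 0 ^+ m * w * sin (theta 0))) /\
  is_derive (0 : R) (1 : R) (fun t => complex.Im (xplane m (rho t) (theta t)))
   ((mR - 1) ^+ 2 / (4 * mR) * ((mR + 1) * w) * cos (mR * theta 0 + theta 0)
    - (mR + 1) ^+ 2 / (4 * mR) * ((mR - 1) * w) * cos (mR * theta 0 - theta 0)
    - amp * (mR * rho 0 ^+ m.-1 * dr * sin (theta 0) + rho 0 ^+ m * w * cos (theta 0))).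
Proof.
move=> drho dtheta.
have dm : is_derive (0 : R) (1 : R) (fun t => mR * theta t) (mR * w) by exact: is_deriveZ.
have dD := is_deriveD dm dtheta; have dB := is_deriveB dm dtheta.
have dX : is_derive (0 : R) (1 : R) (fun t => rho t ^+ m) (mR * rho 0 ^+ m.-1 * dr).
  rewrite (_ : (fun t => _) = rho ^+ m); first exact: is_deriveX.
  by apply/funext => t; rewrite fctE.
have dcos (g : R -> R) dg : is_derive (0 : R) (1 : R) g dg ->
   is_derive (0 : R) (1 : R) (fun t => cos (g t)) (- sin (g 0) * dg).
  by move=> dg'; have := is_derive1_comp (is_derive_cos (g 0)) dg'.
have dsin (g : R -> R) dg : is_derive (0 : R) (1 : R) g dg ->
   is_derive (0 : R) (1 : R) (fun t => sin (g t)) (cos (g 0) * dg).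
  by move=> dg'; have := is_derive1_comp (is_derive_sin (g 0)) dg'.
have dZ (c : R) (g : R -> R) dg : is_derive (0 : R) (1 : R) g dg ->
   is_derive (0 : R) (1 : R) (fun t => c * g t) (c * dg) by move=> dg'; exact: is_deriveZ.
split.
  rewrite (_ : (fun t => complex.Re _) =
      ((fun t => (mR - 1) ^+ 2 / (4 * mR) * cos (mR * theta t + theta t)) +
       (fun t => (mR + 1) ^+ 2 / (4 * mR) * cos (mR * theta t - theta t))) -
      (fun t => amp * rho t ^+ m) * (fun t => cos (theta t))); last first.
    by apply/funext => t; rewrite xplane_Re !fctE.
  have H := is_deriveB (is_deriveD (dZ ((mR - 1) ^+ 2 / (4 * mR)) _ _ (dcos _ _ dD))
    (dZ ((mR + 1) ^+ 2 / (4 * mR)) _ _ (dcos _ _ dB)))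
    (is_deriveM (dZ amp _ _ dX) (dcos _ _ dtheta)).
  by apply: is_derive_eq H _; rewrite /GRing.scale /=; ring.
rewrite (_ : (fun t => complex.Im _) =
    ((fun t => (mR - 1) ^+ 2 / (4 * mR) * sin (mR * theta t + theta t)) -
     (fun t => (mR + 1) ^+ 2 / (4 * mR) * sin (mR * theta t - theta t))) -
    (fun t => amp * rho t ^+ m) * (fun t => sin (theta t))); last first.
  by apply/funext => t; rewrite xplane_Im !fctE.
have H := is_deriveB (is_deriveB (dZ ((mR - 1) ^+ 2 / (4 * mR)) _ _ (dsin _ _ dD))
  (dZ ((mR + 1) ^+ 2 / (4 * mR)) _ _ (dsin _ _ dB)))
  (is_deriveM (dZ amp _ _ dX) (dsin _ _ dtheta)).
by apply: is_derive_eq H _; rewrite /GRing.scale /=; ring.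
Qed.

Lemma row2_eq0 (v : 'rV[R]_2) : v 0 0 = 0 -> v 0 1 = 0 -> v = 0.
Proof. by move=> v0 v1; apply/rowP; apply: forall_ord2; rewrite [RHS]mxE. Qed.

(** Let [w] be the variation of [theta] along [v]. Multiplied by [exp (- i theta)],
    the derivative of [x_1 + i x_2] has imaginary part proportional to
    [w * (r^m + 2 cos (m theta))], so a kernel vector has [w = 0] where that factor
    does not vanish; the real part then gives [dr = 0], hence [v = 0] if [r <> 0].
    At [r = 0] the real part gives [w = s dr = 0], hence [dr = 0] if [s <> 0], and
    [x_0 - x_3] is affine in [s] with nonzero slope on the line [r = 0]. *)
Lemma immersive_patch_map k p v :
  (p 0 0 != 0 -> p 0 0 ^+ m + 2 * cos (mR * patch_angle k p) != 0) ->
  (p 0 0 = 0 -> p 0 1 != 0) ->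
  'd (patch_map k) p v = 0 -> v = 0.
Proof.
move=> p_regular p_line dv0.
pose r t := t * v 0 0 + p 0 0; pose s t := t * v 0 1 + p 0 1.
pose theta t := alpha k + r t * s t.
have [m0 mB mD] := mR_neq (R := R) _ m_ge2.
have d_affine (a b : R) : is_derive (0 : R) (1 : R) (fun t => t * a + b) a.
  have H := is_deriveD (is_deriveM (is_derive_id (0 : R) (1 : R)) (is_derive_cst a (0 : R) (1 : R)))
    (is_derive_cst b (0 : R) (1 : R)).
  apply: is_derive_eq H _; rewrite !fctE /GRing.scale /=; ring.
have dr := d_affine (v 0 0) (p 0 0); have ds := d_affine (v 0 1) (p 0 1).
pose w := v 0 0 * p 0 1 + p 0 0 * v 0 1.
have dtheta : is_derive (0 : R) (1 : R) theta w.
  have H := is_deriveD (is_derive_cst (alpha k) (0 : R) (1 : R)) (is_deriveM dr ds).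
  by apply: is_derive_eq H _; rewrite /w /GRing.scale /=; ring.
have coords t : ((t *: v + p) 0 0 = r t) * ((t *: v + p) 0 1 = s t) by rewrite !mxE.
have dj j := is_derive_coord _ (patch_map k) p v j (differentiable_patch_map k p).
have [dRe dIm] := is_derive_xplane r theta _ _ dr dtheta.
have derive_eq (f g : R -> R) (a b : R) : is_derive (0 : R) (1 : R) f a ->
    is_derive (0 : R) (1 : R) g b -> (forall t, f t = g t) -> a = b.
  by move=> [_ <-] [_ <-] /funext ->.
have dv0j j : 'd (patch_map k) p v 0 j = 0 by rewrite dv0 mxE.
have pm_coords t := patch_mapK k (t *: v + p).
have dj0 j : is_derive (0 : R) (1 : R) (fun t => patch_map k (t *: v + p) 0 j) 0.
  by have := dj j; rewrite dv0j.
have fRe t : complex.Re (xplane m (r t) (theta t)) = patch_map k (t *: v + p) 0 1.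
  by have [_ -> _ _] := pm_coords t; rewrite /patch_angle !coords.
have fIm t : complex.Im (xplane m (r t) (theta t)) = patch_map k (t *: v + p) 0 2%:R.
  by have [_ _ -> _] := pm_coords t; rewrite /patch_angle !coords.
have E1 := derive_eq _ _ _ _ dRe (dj0 1) fRe.
have E2 := derive_eq _ _ _ _ dIm (dj0 2%:R) fIm.
have r0E : r 0 = p 0 0 by rewrite /r mul0r add0r.
have th0E : theta 0 = patch_angle k p by rewrite /theta /patch_angle r0E /s mul0r add0r.
have [th thE] : exists th, th = patch_angle k p by exists (patch_angle k p).
rewrite -thE in p_regular; move: E1 E2; rewrite th0E r0E -thE !sinD !cosD sinN cosN.
set rho := p 0 0 ^+ m; set rho' := p 0 0 ^+ m.-1.
set c1 := cos th; set s1 := sin th; set C := cos (mR * th); set S := sin (mR * th).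
have cs : c1 ^+ 2 + s1 ^+ 2 = 1 by exact: cos2Dsin2.
have CS : C ^+ 2 + S ^+ 2 = 1 by exact: cos2Dsin2.
(* [L1] and [L2] are the derivatives of [x_1] and [x_2] along [v]. *)
set L1 := (X in X = 0 -> _); set L2 := (X in _ -> X = 0 -> _) => E1 E2.
have Ew : w * (2 * C + rho) = 0.
  apply: (mulfI (lt0r_neq0 (amp_gt0 m m_ge2))); rewrite mulr0.
  transitivity ((c1 ^+ 2 + s1 ^+ 2) * (amp * (w * (2 * C + rho)))); first by rewrite cs mul1r.
  transitivity (s1 * L1 - c1 * L2); last by rewrite E1 E2 !mulr0 subrr.
  by rewrite /L1 /L2; field.
have Edr : (1 - mR ^+ 2) / 2 * (w * S) = amp * (mR * rho' * v 0 0).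
  apply/eqP; rewrite -subr_eq0; apply/eqP.
  transitivity (c1 * L1 + s1 * L2 +
    (c1 ^+ 2 + s1 ^+ 2 - 1) * (amp * (mR * rho' * v 0 0) - (1 - mR ^+ 2) / 2 * (w * S))).
    by rewrite /L1 /L2; field.
  by rewrite E1 E2 cs subrr !mulr0 mul0r !addr0.
have [p0|p0] := eqVneq (p 0 0) 0; last first.
  have w0 : w = 0.
    by move/eqP: Ew; rewrite mulf_eq0 [2 * C + _]addrC (negbTE (p_regular p0)) orbF => /eqP.
  have dr0 : v 0 0 = 0.
    have rho'_neq0 : rho' != 0 by rewrite expf_neq0.
    move/esym/eqP: Edr; rewrite w0 mul0r mulr0 mulf_eq0 (gt_eqF (amp_gt0 m m_ge2)).
    by rewrite mulf_eq0 mulf_eq0 (negbTE m0) (negbTE rho'_neq0) /= => /eqP.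
  have ds0 : v 0 1 = 0.
    by move/eqP: w0; rewrite /w dr0 mul0r add0r mulf_eq0 (negbTE p0) /= => /eqP.
  by apply: row2_eq0.
have r'0 : rho' = 0 by rewrite /rho' p0 expr0m1.
have dr0 : v 0 0 = 0.
  have S_neq0 : S != 0 by rewrite /S thE /patch_angle p0 mul0r addr0 sin_alpha_neq0.
  have B_neq0 : (1 - mR ^+ 2) / 2 != 0.
    by rewrite -opprB mulNr oppr_eq0 gt_eqF // divr_gt0 // subr_gt0 exprn_egt1 // mR_gt1.
  move/eqP: Edr; rewrite r'0 mulr0 mul0r mulr0 mulf_eq0 (negbTE B_neq0) mulf_eq0.
  rewrite (negbTE S_neq0) orbF /= /w p0 mul0r addr0 mulf_eq0.
  by rewrite (negbTE (p_line p0)) orbF => /eqP.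
apply: row2_eq0 => //.
have dxm : is_derive (0 : R) (1 : R)
    (fun t => - (amp * (2 * sin (mR * alpha k)) * mR) * s t - amp * ((mR + 1) / (mR - 1) * 0 ^+ m.-1))
    (- (amp * (2 * sin (mR * alpha k)) * mR) * v 0 1).
  have H := is_deriveD (is_deriveM (is_derive_cst (- (amp * (2 * sin (mR * alpha k)) * mR))
      (0 : R) (1 : R)) ds)
    (is_derive_cst (- (amp * ((mR + 1) / (mR - 1) * 0 ^+ m.-1))) (0 : R) (1 : R)).
  by apply: is_derive_eq H _; rewrite /GRing.scale /=; ring.
have dxm0 := is_deriveB (dj0 0) (dj0 3%:R).
have fxm t : patch_map k (t *: v + p) 0 0 - patch_map k (t *: v + p) 0 3%:R =
    - (amp * (2 * sin (mR * alpha k)) * mR) * s t - amp * ((mR + 1) / (mR - 1) * 0 ^+ m.-1).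
  have [-> _ _ ->] := pm_coords t.
  rewrite /patch_xminus !coords /r dr0 p0 mulr0 add0r !mul0r mulr0 sinc0.
  by field; rewrite m0 mB.
have /esym/eqP := derive_eq _ _ _ _ dxm0 dxm fxm.
have slope_neq0 : amp * (2 * sin (mR * alpha k)) * mR != 0.
  apply: mulf_neq0 => //; apply: mulf_neq0; first exact: (lt0r_neq0 (amp_gt0 m m_ge2)).
  by apply: mulf_neq0; rewrite ?pnatr_eq0 ?sin_alpha_neq0.
by rewrite subrr mulf_eq0 oppr_eq0 (negbTE slope_neq0) /= => /eqP.
Qed.
End PatchMap.

(** * Closedness *)

Section ClosedGraph.
Context {R : realType} (m : nat) (m_ge2 : (2 <= m)%N).
Local Notation mR := (m%:R : R).
Local Notation amp := ((mR ^+ 2 - 1) / (4 * mR)).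
Implicit Types (p : R * R) (X : 'rV[R]_4).

(** Turns the relation into one equation between continuous functions, so that
    its failure is an open condition. *)
Definition graph_defect p X : R :=
  `|X 0 0 + X 0 3%:R - xplus m p.1 p.2| +
  `|p.1 * (X 0 0 - X 0 3%:R) -
    amp * (2 * cos (mR * p.2) - (mR + 1) / (mR - 1) * p.1 ^+ m)| +
  `|X 0 1 - complex.Re (xplane m p.1 p.2)| +
  `|X 0 2%:R - complex.Im (xplane m p.1 p.2)|.

Lemma graph_defectP p X : on_graph m p X <-> graph_defect p X = 0.
Proof.
rewrite /on_graph /graph_defect; split=> [[-> -> -> ->]|/eqP].
  by rewrite !subrr !normr0 !addr0.
rewrite !paddr_eq0 ?addr_ge0 // !normr_eq0 !subr_eq0.
by move=> /andP[/andP[/andP[/eqP e0 /eqP e1] /eqP e2] /eqP e3].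
Qed.

Lemma continuous_expr (T : topologicalType) (f : T -> R) n (x : T) :
  {for x, continuous f} -> {for x, continuous (fun y => f y ^+ n)}.
Proof.
move=> cf; elim: n => [|n IH]; first exact: cvg_cst.
rewrite (_ : (fun y => _) = (fun y => f y * f y ^+ n)); first exact: cvgM.
by apply/funext => y; rewrite exprS.
Qed.

Section Continuity.
Context {T : topologicalType} (r theta : T -> R) (x : T).
Hypotheses (c_r : {for x, continuous r}) (c_theta : {for x, continuous theta}).

Let c_pow n : {for x, continuous (fun y => r y ^+ n)}.
Proof. exact: continuous_expr. Qed.

Let c_cos (a b : R) : {for x, continuous (fun y => cos (a * theta y + b * theta y))}.
Proof.
apply: (@continuous_comp _ _ _ (fun y => a * theta y + b * theta y) cos); last exact: continuous_cos.
by apply: cvgD; apply: cvgM => //; exact: cvg_cst.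
Qed.

Let c_sin (a b : R) : {for x, continuous (fun y => sin (a * theta y + b * theta y))}.
Proof.
apply: (@continuous_comp _ _ _ (fun y => a * theta y + b * theta y) sin); last exact: continuous_sin.
by apply: cvgD; apply: cvgM => //; exact: cvg_cst.
Qed.

Lemma continuous_cos_mul (a : R) : {for x, continuous (fun y => cos (a * theta y))}.
Proof.
rewrite (_ : (fun y => _) = (fun y => cos (a * theta y + 0 * theta y))); first exact: c_cos.
by apply/funext => y; rewrite mul0r addr0.
Qed.

Lemma continuous_xplus : {for x, continuous (fun y => xplus m (r y) (theta y))}.
Proof.
apply: cvgM; first by apply: cvgM => //; exact: cvg_cst.
by apply: cvgB; apply: cvgM; try exact: cvg_cst; [exact: continuous_cos_mul | exact: c_pow].
Qed.

Lemma continuous_xplane_Re :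
  {for x, continuous (fun y => complex.Re (xplane m (r y) (theta y)))}.
Proof.
rewrite (_ : (fun y => _) = (fun y =>
   (mR - 1) ^+ 2 / (4 * mR) * cos (mR * theta y + 1 * theta y)
  + (mR + 1) ^+ 2 / (4 * mR) * cos (mR * theta y + (-1) * theta y)
  - amp * r y ^+ m * cos (1 * theta y))); last first.
  by apply/funext => y; rewrite xplane_Re mulN1r !mul1r.
apply: cvgB; first by apply: cvgD; apply: cvgM; try exact: cvg_cst; exact: c_cos.
by apply: cvgM; [apply: cvgM; [exact: cvg_cst | exact: c_pow] | exact: continuous_cos_mul].
Qed.

Lemma continuous_xplane_Im :
  {for x, continuous (fun y => complex.Im (xplane m (r y) (theta y)))}.
Proof.
rewrite (_ : (fun y => _) = (fun y =>
   (mR - 1) ^+ 2 / (4 * mR) * sin (mR * theta y + 1 * theta y)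
  - (mR + 1) ^+ 2 / (4 * mR) * sin (mR * theta y + (-1) * theta y)
  - amp * r y ^+ m * sin (1 * theta y + 0 * theta y))); last first.
  by apply/funext => y; rewrite xplane_Im mulN1r mul0r addr0 !mul1r.
apply: cvgB; first by apply: cvgB; apply: cvgM; try exact: cvg_cst; exact: c_sin.
by apply: cvgM; [apply: cvgM; [exact: cvg_cst | exact: c_pow] | exact: c_sin].
Qed.

End Continuity.

Lemma continuous_graph_defect :
  continuous (fun z : (R * R) * 'rV[R]_4 => graph_defect z.1 z.2).
Proof.
move=> z.
have c_r : {for z, continuous (fun y : (R * R) * 'rV[R]_4 => y.1.1)}.
  by apply: (@continuous_comp _ _ _ fst fst); exact: cvg_fst.
have c_th : {for z, continuous (fun y : (R * R) * 'rV[R]_4 => y.1.2)}.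
  by apply: (@continuous_comp _ _ _ fst snd); [exact: cvg_fst | exact: cvg_snd].
have c_X j : {for z, continuous (fun y : (R * R) * 'rV[R]_4 => y.2 0 j)}.
  apply: (@continuous_comp _ _ _ snd (fun X : 'rV[R]_4 => X 0 j)); first exact: cvg_snd.
  exact: coord_continuous.
apply: cvgD; last by apply: cvg_norm; apply: cvgB => //;
  [exact: c_X | exact: (continuous_xplane_Im _ _ _ c_r c_th)].
apply: cvgD; last by apply: cvg_norm; apply: cvgB => //;
  [exact: c_X | exact: (continuous_xplane_Re _ _ _ c_r c_th)].
apply: cvgD; apply: cvg_norm; apply: cvgB.
- by apply: cvgD; exact: c_X.
- exact: (continuous_xplus _ _ _ c_r c_th).
- by apply: cvgM => //; apply: cvgB; exact: c_X.
apply: cvgM; first exact: cvg_cst.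
apply: cvgB; apply: cvgM; try exact: cvg_cst; first exact: (continuous_cos_mul _ _ c_th).
exact: (continuous_expr _ _ _ _ c_r).
Qed.

(** [x_1] and [x_2] control [r^m], because [|gamma_m|] is bounded. *)
Lemma on_graph_bounded (N : R) : exists B : R, forall p X, on_graph m p X ->
  `|X 0 1| <= N -> `|X 0 2%:R| <= N -> `|p.1| <= B.
Proof.
set A := (mR - 1) ^+ 2 / (4 * mR); set A' := (mR + 1) ^+ 2 / (4 * mR).
exists (1 + (2 * (`|A| + `|A'| + N)) / amp) => p X [_ _ e1 e2] X1 X2.
have cosM (a x : R) : `|a * cos x| <= `|a| by rewrite normrM ler_piMr // cos_max.
have sinM (a x : R) : `|a * sin x| <= `|a| by rewrite normrM ler_piMr // sin_max.
set rho := amp * p.1 ^+ m.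
have rho1 : `|rho * cos p.2| <= `|A| + `|A'| + N.
  have -> : rho * cos p.2 = A * cos (mR * p.2 + p.2) + A' * cos (mR * p.2 - p.2) - X 0 1.
    by rewrite e1 xplane_Re -/A -/A' -/rho; ring.
  apply: le_trans (ler_normB _ _) _; apply: lerD => //.
  by apply: le_trans (ler_normD _ _) _; apply: lerD.
have rho2 : `|rho * sin p.2| <= `|A| + `|A'| + N.
  have -> : rho * sin p.2 = A * sin (mR * p.2 + p.2) - A' * sin (mR * p.2 - p.2) - X 0 2%:R.
    by rewrite e2 xplane_Im -/A -/A' -/rho; ring.
  apply: le_trans (ler_normB _ _) _; apply: lerD => //.
  by apply: le_trans (ler_normB _ _) _; apply: lerD.
have rhoB : `|rho| <= 2 * (`|A| + `|A'| + N).
  have -> : rho = rho * cos p.2 * cos p.2 + rho * sin p.2 * sin p.2.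
    by rewrite -[LHS]mulr1 -(cos2Dsin2 p.2); ring.
  rewrite [leRHS]mulr_natl mulr2n.
  apply: le_trans (ler_normD _ _) _; apply: lerD.
    by apply: le_trans rho1; exact: cosM.
  by apply: le_trans rho2; exact: sinM.
have amp_pos := amp_gt0 (R := R) m m_ge2.
have powB : `|p.1| ^+ m <= 2 * (`|A| + `|A'| + N) / amp.
  by rewrite ler_pdivlMr // (le_trans _ rhoB) // normrM normrX (ger0_norm (ltW amp_pos)) mulrC.
have pow0 : 0 <= `|p.1| ^+ m by rewrite exprn_ge0.
have [p1|p1] := leP `|p.1| 1; first by rewrite (le_trans p1) // lerDl (le_trans pow0).
apply: (@le_trans _ _ (`|p.1| ^+ m)); last by rewrite (le_trans powB) // lerDr.
by rewrite ler_eXnr ?ltW // (leq_trans _ m_ge2).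
Qed.

(** Near [X] the parameter [r] is bounded and [theta] can be taken in [0, 2 pi], so
    the graph is locally the projection of a closed relation along a compact
    factor. *)
Lemma closed_graph (D : set R) : closed D -> closed (graph m D).
Proof.
move=> cD; rewrite -(setCK (graph m D)); apply: open_closedC; rewrite openE => X nX.
have [B HB] := on_graph_bounded (`|X| + 1).
pose P : set (R * R) := (D `&` `[- B, B]%classic) `*` `[0, pi *+ 2]%classic.
have cP : compact P.
  apply: compact_setX; last exact: segment_compact.
  by rewrite setIC; apply: compact_closedI => //; exact: segment_compact.
have near_P : \forall Y \near X, P `<=` (fun p => ~ on_graph m p Y).
  apply: (iffLR (compact_near_coveringP P) cP _ (nbhs X) (fun Y p => ~ on_graph m p Y)) => p [[Dp _] _].
  have neq0 : graph_defect p X != 0.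
    by apply/eqP => /graph_defectP gX; apply: nX; exists p.
  have nz : nbhs (p, X) [set z : (R * R) * 'rV[R]_4 | graph_defect z.1 z.2 != 0].
    apply: (continuous_graph_defect (p, X) [set y | y != 0]).
    by apply: open_nbhs_nbhs; split=> //; exact: open_neq.
  by apply: filterS nz => -[q Y] /= /eqP qY /graph_defectP.
have near_X : \forall Y \near X, `|Y| <= `|X| + 1.
  apply/nbhs_normP; exists 1 => //= Y; rewrite /ball_ /= => XY.
  rewrite -[Y](subrK X) addrC; apply: le_trans (ler_normD _ _) _.
  by rewrite lerD2l distrC ltW.
near=> Y => -[[r theta] /= Dr gY].
have YX : `|Y| <= `|X| + 1 by near: Y.
have [phi /andP[phi0 phi1] /esym e] := cis_representative theta.
have gY' := on_graph_cis _ _ _ _ _ e gY.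
suff Pr : P (r, phi) by move: gY'; apply: (near near_P Y) Pr.
split=> /=; last by rewrite in_itv /= phi0 ltW.
split=> //; rewrite /= in_itv /= -ler_norml.
by apply: (HB (r, theta) Y gY); apply: le_trans (ler_coord_norm _ _) YX.
Unshelve. all: by end_near. Qed.

(** Agrees with [f_I_ext] on the singular set, where substituting
    [2 cos (m theta) = - r^m] cancels the factor [1 / r] of [x_0 - x_3]; unlike
    [f_I_ext] it is continuous at [r = 0]. *)
Definition singular_map p : 'rV[R]_4 :=
  let xp := xplus m p.1 p.2 in
  let xm := - (amp * (1 + (mR + 1) / (mR - 1)) * p.1 ^+ m.-1) in
  let xy := xplane m p.1 p.2 in
  Defs.point ((xp + xm) / 2) (complex.Re xy) (complex.Im xy) ((xp - xm) / 2).

Lemma row4_continuous (T : topologicalType) (F : T -> 'rV[R]_4) (x : T) :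
  {for x, continuous (fun y => F y 0 0)} -> {for x, continuous (fun y => F y 0 1)} ->
  {for x, continuous (fun y => F y 0 2%:R)} -> {for x, continuous (fun y => F y 0 3%:R)} ->
  {for x, continuous F}.
Proof.
move=> c0 c1 c2 c3.
have c j : (fun y => F y 0 j) @ x --> F x 0 j.
  by move: j; exact: forall_ord4.
apply/cvgrPdist_lt => e e0; near=> y; apply: row_norm_lt => // j; rewrite !mxE.
move: j; near: y; apply: filter_forall => j.
by have /cvgrPdist_lt := c j; apply.
Unshelve. all: by end_near. Qed.

Lemma singular_map_continuous : continuous singular_map.
Proof.
move=> p.
have c_r : {for p, continuous (fun y : R * R => y.1)} by exact: cvg_fst.
have c_th : {for p, continuous (fun y : R * R => y.2)} by exact: cvg_snd.
have c_xp := continuous_xplus _ _ _ c_r c_th.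
have c_xm : {for p, continuous (fun y : R * R =>
    - (amp * (1 + (mR + 1) / (mR - 1)) * y.1 ^+ m.-1))}.
  by apply: cvgN; apply: cvgM; [exact: cvg_cst | exact: (continuous_expr _ _ _ _ c_r)].
have funE j g : (forall q, singular_map q 0 j = g q) -> {for p, continuous g} ->
    {for p, continuous (fun q => singular_map q 0 j)}.
  by move=> /funext ->.
apply: row4_continuous.
- apply: (funE _ (fun q => (xplus m q.1 q.2 + - (amp * (1 + (mR + 1) / (mR - 1)) * q.1 ^+ m.-1)) / 2)).
    by move=> q; rewrite /singular_map mxE.
  by apply: cvgM; [apply: cvgD | exact: cvg_cst].
- apply: (funE _ (fun q => complex.Re (xplane m q.1 q.2))).
    by move=> q; rewrite /singular_map mxE.
  exact: (continuous_xplane_Re _ _ _ c_r c_th).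
- apply: (funE _ (fun q => complex.Im (xplane m q.1 q.2))).
    by move=> q; rewrite /singular_map mxE.
  exact: (continuous_xplane_Im _ _ _ c_r c_th).
- apply: (funE _ (fun q => (xplus m q.1 q.2 - - (amp * (1 + (mR + 1) / (mR - 1)) * q.1 ^+ m.-1)) / 2)).
    by move=> q; rewrite /singular_map mxE.
  by apply: cvgM; [apply: cvgB | exact: cvg_cst].
Qed.

End ClosedGraph.

(** * The exceptional set, the closure and the symmetries *)

Section Sets.
Context {R : realType} (m : nat) (m_ge2 : (2 <= m)%N).
Local Notation mR := (m%:R : R).
Local Notation amp := ((mR ^+ 2 - 1) / (4 * mR)).
Implicit Types (p : R * R) (X : 'rV[R]_4).

Let m_gt0 : (0 < m)%N. Proof. exact: leq_trans m_ge2. Qed.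

Lemma on_graph_singular_map p : p.1 ^+ m + 2 * cos (mR * p.2) = 0 ->
  on_graph m p (singular_map m p).
Proof.
move=> /eqP; rewrite addrC addr_eq0 => /eqP sing.
have [e0 e1 e2 e3] := pointK
  ((xplus m p.1 p.2 + - (amp * (1 + (mR + 1) / (mR - 1)) * p.1 ^+ m.-1)) / 2)
  (complex.Re (xplane m p.1 p.2)) (complex.Im (xplane m p.1 p.2))
  ((xplus m p.1 p.2 - - (amp * (1 + (mR + 1) / (mR - 1)) * p.1 ^+ m.-1)) / 2).
have [m0 mB mD] := mR_neq (R := R) _ m_ge2.
rewrite /on_graph /singular_map e0 e1 e2 e3; split=> //; first by field; rewrite m0 mB.
rewrite sing (_ : p.1 ^+ m = p.1 * p.1 ^+ m.-1); last by rewrite -exprS prednK.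
by field; rewrite m0 mB.
Qed.

Lemma singular_map0 (theta : R) : singular_map m (0, theta) =
  Defs.point 0 (complex.Re (xplane m 0 theta)) (complex.Im (xplane m 0 theta)) 0.
Proof.
apply: pointE; rewrite // /xplus /= (expr0m1 m m_ge2).
  by rewrite !(mulr0, mul0r) oppr0 addr0 mul0r.
by rewrite !(mulr0, mul0r) oppr0 subr0 mul0r.
Qed.

(** Restricting to [|r| <= 2] and [0 <= theta <= 2 pi] loses nothing, since
    [|r|^m = 2 |cos (m theta)| <= 2]. The points with [r = 0] are the limits of the
    singular set and give the points of the lines [L_k] with [t = 0]. *)
Definition singular_locus : set (R * R) :=
  [set p | p.1 ^+ m + 2 * cos (mR * p.2) = 0] `&` (`[-2, 2]%classic `*` `[0, pi *+ 2]%classic).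

Lemma compact_singular_locus : compact singular_locus.
Proof.
rewrite /singular_locus setIC; apply: compact_closedI.
  by apply: compact_setX; exact: segment_compact.
rewrite (_ : [set p | _] = (fun p : R * R => p.1 ^+ m + 2 * cos (mR * p.2)) @^-1` [set 0]) //.
apply: preimage_closed; last exact: closed_eq.
move=> p _; apply: cvgD.
  by apply: continuous_expr; exact: cvg_fst.
apply: cvgM; first exact: cvg_cst.
by apply: (continuous_cos_mul snd); exact: cvg_snd.
Qed.

Lemma exceptional_setE : @exceptional_set R m = singular_map m @` singular_locus.
Proof.
have pi0 := pi_gt0 R.
apply/seteqP; split=> [X [[[r theta] [/= r0 sing] <-]|[k k_lt <-]]|_ [[r theta] [sing _] <-]].
- have [phi /andP[phi0 phi1] e] := cis_representative theta.
  have [cE _] := eq_cis_mul m _ _ e.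
  have sing' : r ^+ m + 2 * cos (mR * phi) = 0 by rewrite cE.
  exists (r, phi).
    split=> //; split; last by rewrite /= in_itv /= phi0 ltW.
    rewrite /= in_itv /= -ler_norml; have [r1|r1] := leP `|r| 1; first by lra.
    apply: (@le_trans _ _ (`|r| ^+ m)); first by rewrite ler_eXnr // ltW.
    move/eqP: sing; rewrite addr_eq0 => /eqP sing; rewrite -normrX sing normrN normrM.
    by rewrite [`|2|]ger0_norm // ler_piMr // cos_max.
  have g1 := on_graph_singular_map (r, phi) sing'.
  have g2 := on_graph_cis _ _ _ _ _ e g1.
  exact: (iffLR (on_graph_f_I_ext _ (r, theta) _ r0) g2).
- have [phi /andP[phi0 phi1] e] := cis_representative (alpha R m k).
  have cphi : cos (mR * phi) = 0 by have [-> _] := eq_cis_mul m _ _ e; exact: cos_alpha.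
  exists (0, phi).
    split; first by rewrite /= expr0m // cphi mulr0 addr0.
    split; first by rewrite /= in_itv /=; apply/andP; split; lra.
    by rewrite /= in_itv /= phi0 ltW.
  by rewrite singular_map0 gamma_mE //; have [-> ->] := eq_cis_xplane m 0 _ _ e.
have [r0|r0] := eqVneq r 0.
  right; rewrite r0 in sing *.
  have c0 : cos (mR * theta) = 0.
    by move/eqP: sing; rewrite /= expr0m // add0r mulf_eq0 pnatr_eq0 => /eqP.
  have [k k_lt e] := cos_mul_eq0 _ m_ge2 _ c0; exists k => //.
  by rewrite singular_map0 gamma_mE //; have [-> ->] := eq_cis_xplane m 0 _ _ e.
left; exists (r, theta) => //.
by apply/esym/(on_graph_f_I_ext _ (r, theta) _ r0)/on_graph_singular_map.
Qed.

Lemma compact_exceptional_set : compact (@exceptional_set R m).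
Proof.
rewrite exceptional_setE; apply: continuous_compact; last exact: compact_singular_locus.
by apply: continuous_subspaceT => p; exact: singular_map_continuous.
Qed.

Lemma lightline_patch_map k X : @lightline R m k X ->
  exists2 q : 'rV[R]_2, q 0 0 = 0 & patch_map m k q = X.
Proof.
move=> lX; have [e0 _ e1 e2] := lightline_on_graph _ m_ge2 _ _ lX.
pose slope := amp * (2 * sin (mR * alpha R m k)) * mR.
have [m0 _ _] := mR_neq (R := R) _ m_ge2.
have slope_neq0 : slope != 0.
  apply: mulf_neq0 => //; apply: mulf_neq0; first exact: (lt0r_neq0 (amp_gt0 m m_ge2)).
  by apply: mulf_neq0; rewrite ?pnatr_eq0 ?sin_alpha_neq0.
pose q : 'rV[R]_2 := \row_j [:: 0; - (2 * X 0 0) / slope]`_j.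
have q0 : q 0 0 = 0 by rewrite mxE.
have q1 : q 0 1 = - (2 * X 0 0) / slope by rewrite mxE.
exists q => //.
have ang : patch_angle m k q = alpha R m k by rewrite /patch_angle q0 mul0r addr0.
have xp0 : xplus m 0 (alpha R m k) = 0 by rewrite /xplus mulr0 mul0r.
have xm : patch_xminus m k q = 2 * X 0 0.
  rewrite /patch_xminus q0 q1 mul0r mulr0 sinc0 (expr0m1 m m_ge2) mulr0 subr0 mulr1.
  have slopeM (y : R) : amp * (- (2 * sin (mR * alpha R m k)) * (mR * - y)) = slope * y.
    by rewrite /slope; ring.
  by rewrite [- _ / slope]mulNr slopeM mulrC divfK.
have [p0 p1 p2 p3] := patch_mapK m k q.
have X3 : X 0 3%:R = - X 0 0.
  by apply/eqP; rewrite -addr_eq0 addrC e0 /= xp0.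
apply: row4P; rewrite ?p0 ?p1 ?p2 ?p3 ang q0 ?xp0 ?xm ?e1 ?e2 ?X3 //=; by field.
Qed.

Lemma patch_map_f_I_ext k (q : 'rV[R]_2) : q 0 0 != 0 ->
  patch_map m k q = f_I_ext m (q 0 0, patch_angle m k q).
Proof.
by move=> q0; apply/(on_graph_f_I_ext _ (q 0 0, patch_angle m k q) _ q0)/patch_on_graph.
Qed.

(** A point of [L_k] is the limit of the surface, as [r -> 0+], along one of the
    curves [theta = alpha_k + r s]. *)
Lemma lightline_closure k :
  @lightline R m k `<=` closure (@f_I_ext R m @` @Omega_pos R).
Proof.
move=> X /lightline_patch_map [q q0 <-] B nB.
have /nbhs_normP[e /= e0 eB] := patch_map_continuous m k q _ nB.
pose q' : 'rV[R]_2 := \row_j [:: e / 2; q 0 1]`_j.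
have q'0 : q' 0 0 = e / 2 by rewrite mxE.
have q'1 : q' 0 1 = q 0 1 by rewrite mxE.
have e2 : 0 < e / 2 by rewrite divr_gt0.
exists (patch_map m k q'); split.
  exists (q' 0 0, patch_angle m k q'); first by rewrite /Omega_pos /= q'0.
  by rewrite -patch_map_f_I_ext // q'0 gt_eqF.
apply: eB; rewrite /ball_ /=; apply: row_norm_lt => //; apply: forall_ord2.
  by rewrite !mxE q0 sub0r normrN gtr0_norm // ltr_pdivrMr // ltr_pMr // ltr1n.
by rewrite !mxE subrr normr0.
Qed.

Lemma graph_deSitter (D : set R) : graph m D `<=` @deSitter R.
Proof. by move=> X [p _]; exact: on_graph_deSitter. Qed.

Lemma closure_f_IE : @closure_f_I R m = graph m [set r | 0 <= r].
Proof.
have fE : @f_I_polar R m @` @Omega_pos R = @f_I_ext R m @` @Omega_pos R.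
  by apply/seteqP; split=> _ [p p0 <-]; exists p => //; rewrite f_I_polarE.
have sub : @f_I_ext R m @` @Omega_pos R `<=` graph m [set r | 0 <= r].
  by rewrite graph_ge0E // => X; left.
rewrite /closure_f_I fE closure_subspaceW; last first.
  exact: subset_trans sub (graph_deSitter _).
apply/seteqP; split=> [X [clX _]|X gX].
  have cg : closed (graph m [set r : R | 0 <= r]) by apply: closed_graph => //; exact: closed_ge.
  by rewrite (iffLR (closure_id _) cg); exact: closureS sub _ clX.
split; last exact: graph_deSitter gX.
move: gX; rewrite graph_ge0E // => -[|[k _]]; first exact: subset_closure.
exact: lightline_closure.
Qed.

Lemma on_graph_odd (r theta : R) X : odd m ->
  on_graph m (r, theta) X -> on_graph m (- r, theta + pi) X.
Proof.
move=> m_odd.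
have shift : mR * (theta + pi) = mR * theta + pi *+ m by rewrite mulrDr [mR * pi]mulr_natl.
have cpi : cos (mR * (theta + pi)) = - cos (mR * theta).
  by rewrite shift (alternatingn (@cosDpi R)) -signr_odd m_odd expr1 mulN1r.
have spi : sin (mR * (theta + pi)) = - sin (mR * theta).
  by rewrite shift (alternatingn (@sinDpi R)) -signr_odd m_odd expr1 mulN1r.
have powN : (- r) ^+ m = - r ^+ m by rewrite exprNn -signr_odd m_odd expr1 mulN1r.
rewrite /on_graph !xplane_Re !xplane_Im /xplus /= => -[e0 e1 e2 e3].
have [c1 s1] := (cosDpi theta, sinDpi theta).
move: (theta + pi) cpi spi c1 s1 => phi cpi spi c1 s1.
rewrite !(cosD, sinD, cosN, sinN) in e2 e3 *; rewrite cpi spi c1 s1 powN; split.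
- by rewrite e0; ring.
- by rewrite mulNr e1; ring.
- by rewrite e2; ring.
- by rewrite e3; ring.
Qed.

Lemma on_graph_even (r theta : R) X : ~~ odd m ->
  on_graph m (r, theta) X -> on_graph m (- r, theta) (iota_tz X).
Proof.
move=> m_even; have powN : (- r) ^+ m = r ^+ m.
  by rewrite exprNn -signr_odd (negbTE m_even) expr0 mul1r.
have [i0 i1 i2 i3] := pointK (- X 0 0) (X 0 1) (X 0 2%:R) (- X 0 3%:R).
rewrite /on_graph /iota_tz !xplane_Re !xplane_Im /xplus i0 i1 i2 i3 /= powN.
move=> [e0 e1 -> ->]; split=> //.
- by rewrite -opprD e0; ring.
- by rewrite -opprB opprK mulrC mulrN mulNr opprK mulrC -e1; ring.
Qed.

Lemma iota_tzK X : iota_tz (iota_tz X) = X.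
Proof.
have [i0 i1 i2 i3] := pointK (- X 0 0) (X 0 1) (X 0 2%:R) (- X 0 3%:R).
have [j0 j1 j2 j3] := pointK (- - X 0 0) (X 0 1) (X 0 2%:R) (- - X 0 3%:R).
rewrite {1}/iota_tz i0 i1 i2 i3.
by apply: row4P; rewrite ?j0 ?j1 ?j2 ?j3 ?opprK.
Qed.

Lemma lorentz_iota_tz X Y : lorentz (iota_tz X) (iota_tz Y) = lorentz X Y.
Proof.
have [i0 i1 i2 i3] := pointK (- X 0 0) (X 0 1) (X 0 2%:R) (- X 0 3%:R).
have [j0 j1 j2 j3] := pointK (- Y 0 0) (Y 0 1) (Y 0 2%:R) (- Y 0 3%:R).
by rewrite /lorentz i0 i1 i2 i3 j0 j1 j2 j3 !mulrNN.
Qed.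

Lemma iota_tz_linear : linear (@iota_tz R).
Proof.
move=> a X Y.
have [i0 i1 i2 i3] := pointK (- X 0 0) (X 0 1) (X 0 2%:R) (- X 0 3%:R).
have [j0 j1 j2 j3] := pointK (- Y 0 0) (Y 0 1) (Y 0 2%:R) (- Y 0 3%:R).
have [k0 k1 k2 k3] := pointK (- (a *: X + Y) 0 0) ((a *: X + Y) 0 1)
  ((a *: X + Y) 0 2%:R) (- (a *: X + Y) 0 3%:R).
have coordE j : (a *: iota_tz X + iota_tz Y) 0 j = a * iota_tz X 0 j + iota_tz Y 0 j.
  by rewrite !mxE.
apply: row4P; rewrite coordE ?k0 ?k1 ?k2 ?k3 ?i0 ?i1 ?i2 ?i3 ?j0 ?j1 ?j2 ?j3 !mxE; ring.
Qed.

Lemma continuous_iota_tz : continuous (@iota_tz R).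
Proof.
move=> X; have cX j : (fun Y : 'rV[R]_4 => Y 0 j) @ X --> X 0 j by exact: coord_continuous.
have cE (j : 'I_4) (g : 'rV[R]_4 -> R) : (forall Y, iota_tz Y 0 j = g Y) ->
    {for X, continuous g} -> {for X, continuous (fun Y => iota_tz Y 0 j)}.
  by move=> /funext ->.
apply: row4_continuous.
- by apply: (cE _ (fun Y => - Y 0 0)) => [Y|]; [rewrite mxE | exact: (cvgN (cX 0))].
- by apply: (cE _ (fun Y => Y 0 1)) => [Y|]; [rewrite mxE | exact: cX].
- by apply: (cE _ (fun Y => Y 0 2%:R)) => [Y|]; [rewrite mxE | exact: cX].
- by apply: (cE _ (fun Y => - Y 0 3%:R)) => [Y|]; [rewrite mxE | exact: (cvgN (cX 3%:R))].
Qed.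

Lemma isometric_involution_iota_tz : isometric_involution (@iota_tz R).
Proof.
pose lin := GRing.isLinear.Build _ _ _ _ _ iota_tz_linear.
pose L : {linear 'rV[R]_4 -> 'rV[R]_4} := HB.pack (@iota_tz R) lin.
have cL : continuous L by exact: continuous_iota_tz.
split=> [X|X _|X _]; first by rewrite /deSitter /= lorentz_iota_tz.
  exact: iota_tzK.
have dE : 'd (@iota_tz R) X = @iota_tz R :> ('rV[R]_4 -> 'rV[R]_4).
  exact: (@diff_lin _ _ _ L X cL).
split=> [|V W _ _]; first exact: (@linear_differentiable _ _ _ L X cL).
by rewrite dE; exact: lorentz_iota_tz.
Qed.

Lemma graph_odd : odd m -> graph m setT = graph m [set r : R | 0 <= r].
Proof.
move=> m_odd; apply/seteqP; split=> X [[r theta] /= D gX]; last by exists (r, theta).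
have [r0|r0] := leP 0 r; first by exists (r, theta).
by exists (- r, theta + pi); [rewrite /= oppr_ge0 ltW | exact: on_graph_odd].
Qed.

Lemma graph_even : ~~ odd m -> graph m setT =
  graph m [set r : R | 0 <= r] `|` @iota_tz R @` graph m [set r : R | 0 <= r].
Proof.
move=> m_even; apply/seteqP; split=> [X [[r theta] _ gX]|X [[p _ gX]|[Y [[r theta] _ gY] <-]]].
- have [r0|r0] := leP 0 r; first by left; exists (r, theta).
  right; exists (iota_tz X); last exact: iota_tzK.
  by exists (- r, theta); [rewrite /= oppr_ge0 ltW | exact: on_graph_even].
- by exists p.
- by exists (- r, theta) => //; exact: on_graph_even.
Qed.

(** On the half [0 <= r] the function [x_0 + x_3] is bounded above, because its
    leading term in [r] is negative; for even [m] the other half is the image of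
    the first under [iota_tz], so [x_0 + x_3] is not bounded above on it. *)
Lemma graph_even_proper : ~~ odd m -> ~ graph m setT `<=` graph m [set r : R | 0 <= r].
Proof.
move=> m_even; have m1 := mR_gt1 (R := R) _ m_ge2; have amp_pos := amp_gt0 (R := R) m m_ge2.
have m2 : 2 <= mR by rewrite ler_nat.
pose a := (mR - 1) / (mR + 1).
(* With [a >= 1/3], the factor [2 cos (m theta) - a r^m] of [x_0 + x_3] is
   nonpositive as soon as [r > 6]; the value 9 below makes [a r^m - 2] large. *)
have a_ge : 1 / 3 <= a by rewrite /a ler_pdivlMr; lra.
have bounded p X : 0 <= p.1 -> on_graph m p X -> X 0 0 + X 0 3%:R <= 12 * amp.
  move=> r0 [-> _ _ _]; rewrite /xplus -/a -mulrA [leRHS]mulrC ler_pM2l //.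
  have c1 := cos_le1 (mR * p.2).
  have [r1|r1] := leP p.1 1.
    have pow0 : 0 <= a * p.1 ^+ m by rewrite mulr_ge0 ?exprn_ge0 //; lra.
    have : p.1 * (2 * cos (mR * p.2) - a * p.1 ^+ m) <= p.1 * 2 by rewrite ler_wpM2l //; lra.
    by lra.
  have powr : p.1 <= p.1 ^+ m by rewrite ler_eXnr // ltW.
  have [r6|r6] := leP p.1 6.
    have pow0 : 0 <= a * p.1 ^+ m by rewrite mulr_ge0 ?exprn_ge0 //; lra.
    have : p.1 * (2 * cos (mR * p.2) - a * p.1 ^+ m) <= p.1 * 2 by rewrite ler_wpM2l //; lra.
    by lra.
  have : 1 / 3 * 6 <= a * p.1 ^+ m by apply: ler_pM => //; lra.
  move=> apow; have : p.1 * (2 * cos (mR * p.2) - a * p.1 ^+ m) <= 0 by rewrite pmulr_rle0; lra.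
  by lra.
have g9 : on_graph m (- 9 : R, 0 : R) (f_I_ext m (- 9 : R, 0 : R)).
  have n9 : (- 9 : R) != 0 by rewrite oppr_eq0 pnatr_eq0.
  exact: (iffRL (on_graph_f_I_ext m (- 9, 0) _ n9) erefl).
move=> /(_ (f_I_ext m (- 9 : R, 0 : R))) []; first by exists (- 9, 0).
move=> p p0 /(bounded p _ p0); have [-> _ _ _] := g9.
rewrite /xplus /= mulr0 cos0 mulr1 -/a exprNn -signr_odd (negbTE m_even) expr0 mul1r.
rewrite -mulrA [leRHS]mulrC ler_pM2l //.
have pow : 9 ^+ 2 <= 9 ^+ m :> R by rewrite ler_weXn2l // ler1n.
have : 1 / 3 * 9 ^+ 2 <= a * 9 ^+ m by apply: ler_pM.
by lra.
Qed.

End Sets.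

(** * The theorem *)

Theorem theorem2 (R : realType) (m : nat) (m_ge2 : (2 <= m)%N) :
  let C := @catenoid_I R m in
  let K := @closure_f_I R m in
  let S := @exceptional_set R m in
  (* (i) *)
  ((C `<=` @deSitter R /\ @closed (subspace (@deSitter R)) C) /\
   (odd m -> C = K) /\
   (~~ odd m ->
      [/\ isometric_involution (@iota_tz R),
          K `<` C
        & C = K `|` @iota_tz R @` K])) /\
  (* (ii) *)
  (compact S /\
   exists (M : analytic_surface R) (f : M -> 'rV[R]_4),
     [/\ analytic_immersion f,
         range f `<=` @deSitter R
       & range f = C `\` S]).
Proof.
move=> C K S; rewrite /C /K catenoid_IE // closure_f_IE //.
have C_dS := graph_deSitter (R := R) m m_ge2 setT.
split; first split.
- by split=> //; apply: closed_subspaceW; apply: closed_graph => //; exact: closedT.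
- split=> [|m_even]; first exact: graph_odd.
  split; [exact: isometric_involution_iota_tz | | exact: graph_even].
  split; last exact: graph_even_proper.
  by move=> X [p _ gX]; exists p.
have cS : compact S by exact: compact_exceptional_set.
split=> //.
pose W k : set 'rV[R]_2 := [set q | (k < 2 * m)%N /\ ~ S (patch_map m k q)].
have W_open k : open (W k).
  have [k_lt|k_ge] := ltnP k (2 * m); last first.
    rewrite (_ : W k = set0); first exact: open0.
    by apply/seteqP; split=> q // [/=]; rewrite ltnNge k_ge.
  rewrite (_ : W k = patch_map m k @^-1` (~` S)); last first.
    by apply/seteqP; split=> q // [].
  apply: open_comp; first by move=> q _; exact: patch_map_continuous.
  by apply: closed_openC; apply: compact_closed => //; exact: norm_hausdorff.
have immersive k (p v : 'rV[R]_2) : W k p -> 'd (patch_map m k) p v = 0 -> v = 0.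
  move=> [k_lt nS]; apply: immersive_patch_map => // p0.
    apply/eqP => sing; apply: nS; left.
    by exists (p 0 0, patch_angle m k p); rewrite ?patch_map_f_I_ext.
  apply/eqP => p1; apply: nS; right; exists k => //.
  have m_gt0 : (0 < m)%N by exact: leq_trans m_ge2.
  have angle0 : patch_angle m k p = alpha R m k by rewrite /patch_angle p0 mul0r addr0.
  have xm0 : patch_xminus m k p = 0.
    by rewrite /patch_xminus p0 p1 expr0m1 // !(mulr0, mul0r) subrr mulr0.
  rewrite gamma_mE // /patch_map angle0 p0 xm0.
  by apply: pointE; rewrite // /xplus !(mulr0, mul0r) ?addr0 ?subr0 mul0r.
have [M [f [f_imm f_range]]] := immersed_union_of_patches R 4 W (patch_map m)
  W_open (fun k => analytic_patch_map m k (W k)) immersive.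
have rangeE : range f = graph m setT `\` S.
  rewrite f_range; apply/seteqP; split=> [_ [k _ [q [k_lt nS] <-]]|X [gX nS]].
    split=> //; exists (q 0 0, patch_angle m k q) => //; exact: patch_on_graph.
  move: gX => [p _ gX]; have [p0|p0] := eqVneq p.1 0.
    have [|k k_lt lX] := on_graph_lightline m m_ge2 p.2 X.
      by rewrite -p0 -surjective_pairing.
    have [q _ qX] := lightline_patch_map m m_ge2 _ _ lX.
    by exists k => //; exists q => //; split=> //; rewrite qX.
  (* Every point with [r <> 0] lies in the patch of [L_0]. *)
  pose q : 'rV[R]_2 := \row_j [:: p.1; (p.2 - alpha R m 0) / p.1]`_j.
  have q0 : q 0 0 = p.1 by rewrite mxE.
  have q1 : q 0 1 = (p.2 - alpha R m 0) / p.1 by rewrite mxE.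
  have qX : patch_map m 0 q = X.
    rewrite patch_map_f_I_ext // ?q0 // /patch_angle q0 q1 mulrC divfK // addrC subrK.
    by rewrite -surjective_pairing; apply/esym/on_graph_f_I_ext.
  exists 0%N => //; exists q => //; split; last by rewrite qX.
  by rewrite muln_gt0 /= (leq_trans _ m_ge2).
exists M, f; split=> //.
by rewrite rangeE => X [/C_dS].
Qed.
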